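(* Let $N$ be a topologically finite, orientable 3-manifold with an ideal triangulation $\mathcal{T}$. If there is a solution to the hyperbolic gluing equations of $\mathcal{T}$ (together with the parameter relations), i.e. if the deformation variety $\mathfrak{D}(\mathcal{T})$ is non-empty, then all edges in the triangulation are essential.
   Context: Ideal triangulations. An ideal triangulation $\mathcal{T}$ of $N$ consists of a disjoint union $\widetilde{\Delta}=\bigcup_{k=1}^n\widetilde{\Delta}_k$ of standard Euclidean 3-simplices and a collection $\Phi$ of Euclidean isometries (face pairings) identifying the 2-faces of $\widetilde\Delta$ in pairs, such that $N=(\widetilde{\Delta}\setminus\widetilde{\Delta}^{(0)})/\Phi$. Simplices may become singular in the quotient. $N$ is oriented and all 3-simplices carry the induced orientations. Put $P=\widetilde\Delta/\Phi$ (the end-compactification of $N$, a closed pseudo-manifold), so $N=P\setminus P^{(0)}$, where $P^{(k)}$ denotes the set of (possibly singular) $k$-simplices of $P$. The edges of the triangulation are the elements of $P^{(1)}=\{e_1,\dots,e_m\}$. Compact core and essential edges. Let $E$ be an open regular neighbourhood of $P^{(0)}$ in $P$ such that $\partial E$ meets each 3-simplex in exactly four disjoint normal triangles, one at each corner, and let $C=P\setminus E$. An edge $e\in P^{(1)}$ is essential if the arc $e\cap C$ is not homotopic, by a homotopy in $C$ fixing endpoints, to an arc contained in $\partial C$. Hyperbolic gluing equations. Fix the following labelling of the edges of an oriented 3-simplex with vertices $v_0,v_1,v_2,v_3$, ordered compatibly with the orientation: $v_0v_1,v_2v_3$ are labelled $z$; $v_1v_2,v_0v_3$ are labelled $z'$;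 $v_1v_3,v_0v_2$ are labelled $z''$. For each $\sigma_i\in P^{(3)}=\{\sigma_1,\dots,\sigma_n\}$ fix an orientation-preserving simplicial map $f_i:\Delta^3\to\sigma_i$ from the labelled standard simplex, with variables $z_i,z_i',z_i''$. Let $a_{ij},a'_{ij},a''_{ij}$ be the number of edges in $f_i^{-1}(e_j)$ with label $z,z',z''$ respectively. The parameter relations are $z_i(1-z_i'')=1$, $z_i'(1-z_i)=1$, $z_i''(1-z_i')=1$ for all $i$. The hyperbolic gluing equations are $\prod_{i=1}^n z_i^{a_{ij}}(z_i')^{a'_{ij}}(z_i'')^{a''_{ij}}=1$ for all $j=1,\dots,m$. The deformation variety $\mathfrak{D}(\mathcal{T})\subset(\mathbb{C}\setminus\{0\})^{3n}$ is the set of common solutions of the parameter relations and the hyperbolic gluing equations. *)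

(* Defs.v *)
From HB Require Import structures.
From Stdlib Require Import Relation_Operators.
From mathcomp Require Import all_boot all_order all_algebra all_fingroup.
From mathcomp Require Import generic_quotient complex.
From mathcomp Require Import all_classical all_reals all_analysis.
Import Order.TTheory GRing.Theory Num.Theory.
Import numFieldNormedType.Exports.

Set Implicit Arguments.
Unset Strict Implicit.
Unset Printing Implicit Defensive.

Local Open Scope classical_set_scope.
Local Open Scope ring_scope.

(* The vertices of each of the n tetrahedra are numbered by 'I_4, and face f of
   a tetrahedron is the one opposite its vertex f. The isometry pairing face f
   of tetrahedron i with a face of tetrahedron [glue_tet i f] is recorded as the
   permutation [glue_perm i f] that maps the three vertices of face f as the
   isometry does and sends f to the vertex opposite the target face; so the
   target is face [glue_perm i f f] of [glue_tet i f]. *)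
Record triangulation (n : nat) := Triangulation {
  glue_tet : 'I_n -> 'I_4 -> 'I_n;
  glue_perm : 'I_n -> 'I_4 -> {perm 'I_4};
  glue_tetK : forall i f, glue_tet (glue_tet i f) (glue_perm i f f) = i;
  glue_permK : forall i f,
    glue_perm (glue_tet i f) (glue_perm i f f) = (glue_perm i f)^-1%g;
  glue_neq : forall i f, (glue_tet i f, glue_perm i f f) != (i, f)
}.

(* [o i] tells whether the vertex order 0, 1, 2, 3 of tetrahedron i is negative.
   Orientations match across a face when its pairing reverses the induced
   orientations of the faces, that is, when [glue_perm i f] is odd exactly if
   the two vertex orders have the same sign. Under this condition the midpoint
   of an edge cannot have a projective plane as its link, so the complement of
   the vertices in the quotient is an oriented 3-manifold, the interior of a
   compact one. *)
Definition oriented n (T : triangulation n) (o : 'I_n -> bool) : Prop :=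
  forall i f, odd_perm (glue_perm T i f) = ~~ (o i (+) o (glue_tet T i f)).

(* A pair (i, A) with #|A| = 2 is the edge of tetrahedron i spanned by A; it
   lies in face f when f is not in A. *)
Definition glued_edges n (T : triangulation n) : rel ('I_n * {set 'I_4}) :=
  fun a b => [exists f : 'I_4,
    (f \notin a.2) && (b == (glue_tet T a.1 f, glue_perm T a.1 f @: a.2))].

(* The 1-simplices of the quotient. By [glue_tetK] and [glue_permK],
   [glued_edges] is symmetric, so [connect] gives the classes. *)
Definition edges n (T : triangulation n) : {set {set 'I_n * {set 'I_4}}} :=
  [set [set b | connect (glued_edges T) a b]%SET
     | a in [set a : 'I_n * {set 'I_4} | #|a.2| == 2%N]%SET]%SET.

(* The edges of the standard simplex labelled z, z', z'' for k = 0, 1, 2. *)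
Definition label_edges (k : 'I_3) : {set {set 'I_4}} :=
  if k == 0 then [set [set 0; 1]; [set 2; 3]]%SET
  else if k == 1 then [set [set 1; 2]; [set 0; 3]]%SET
  else [set [set 1; 3]; [set 0; 2]]%SET.

(* [f i] is the simplicial map from the labelled standard simplex to
   tetrahedron i. *)
Definition orientation_preserving n (o : 'I_n -> bool)
    (f : 'I_n -> {perm 'I_4}) : Prop :=
  forall i, odd_perm (f i) = o i.

Definition incidence n (f : 'I_n -> {perm 'I_4}) (i : 'I_n)
    (e : {set 'I_n * {set 'I_4}}) (k : 'I_3) : nat :=
  #|[set A in label_edges k | (i, f i @: A) \in e]%SET|.

(* Row i of Z is (z_i, z_i', z_i''). *)
Definition deformation_variety (R : realType) n (T : triangulation n)
    (f : 'I_n -> {perm 'I_4}) : set 'M[R[i]]_(n, 3) :=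
  [set Z |
    [/\ forall i k, Z i k != 0,
        forall i, [/\ Z i 0 * (1 - Z i 2) = 1,
                      Z i 1 * (1 - Z i 0) = 1
                    & Z i 2 * (1 - Z i 1) = 1]
      & forall e, e \in edges T ->
          \prod_(i < n) (Z i 0 ^+ incidence f i e 0
                       * Z i 1 ^+ incidence f i e 1
                       * Z i 2 ^+ incidence f i e 2) = 1]].

Arguments deformation_variety R {n} T f.

Definition simplex3_set (R : realType) : set 'rV[R]_4 :=
  [set x | (forall u, 0 <= x 0 u) /\ \sum_u x 0 u = 1].

Notation simplex3 R := (set_type (@simplex3_set R)).

Definition bary (R : realType) (x : simplex3 R) (u : 'I_4) : R := \val x 0 u.

Notation tetrahedra R n := {i : 'I_n & simplex3 R}.

Section Quotient.
Variables (R : realType) (n : nat) (T : triangulation n).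

Definition glued_points (p q : tetrahedra R n) : Prop :=
  exists f : 'I_4,
    [/\ bary (projT2 p) f = 0,
        projT1 q = glue_tet T (projT1 p) f
      & forall u, bary (projT2 q) (glue_perm T (projT1 p) f u)
                  = bary (projT2 p) u].

Definition same_point (p q : tetrahedra R n) : bool :=
  `[< clos_refl_sym_trans _ glued_points p q >].

Lemma same_point_equiv : equiv_class_of same_point.
Proof.
split=> [p|p q|q p r].
- exact/asboolP/rst_refl.
- by apply/asboolP/asboolP; exact: rst_sym.
- by move=> /asboolP pq /asboolP qr; apply/asboolP; exact: rst_trans pq qr.
Qed.

Canonical same_point_equiv_rel := EquivRelPack same_point_equiv.

Definition pseudo_manifold : topologicalType :=
  quotient_topology {eq_quot same_point_equiv_rel}%qT.

Definition quot_map (i : 'I_n) (x : simplex3 R) : pseudo_manifold :=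
  (\pi_pseudo_manifold (existT _ i x))%qT.

End Quotient.

(* A choice of four disjoint normal triangles in each tetrahedron, one at each
   corner and matching across the faces. The triangle at corner v of tetrahedron
   i is flat and meets the edge vw at the point whose w-coordinate is
   [cut i v w]; the values [cut i v v] play no role. [cut_disj] says that the
   triangles at v and w meet the edge vw in this order, which makes the
   triangles disjoint. *)
Record truncation (R : realType) n (T : triangulation n) := Truncation {
  cut : 'I_n -> 'I_4 -> 'I_4 -> R;
  cut_gt0 : forall i v w, v != w -> 0 < cut i v w;
  cut_disj : forall i v w, v != w -> cut i v w + cut i w v < 1;
  cut_glue : forall i f v w, v != w -> f != v -> f != w ->
    cut (glue_tet T i f) (glue_perm T i f v) (glue_perm T i f w) = cut i v w
}.

Section Core.
Variables (R : realType) (n : nat) (T : triangulation n) (s : truncation R T).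

Definition corner (i : 'I_n) (v : 'I_4) : set (simplex3 R) :=
  [set x | \sum_(w | w != v) bary x w / cut s i v w < 1].

(* The open regular neighbourhood of the vertices of [pseudo_manifold R T]; its
   complement is the compact core. *)
Definition vertex_nbhd : set (pseudo_manifold R T) :=
  \bigcup_(i : 'I_n) \bigcup_(v : 'I_4) (quot_map T i @` corner i v).

Definition core : set (pseudo_manifold R T) := ~` vertex_nbhd.

End Core.

(* The boundary of the core, that is, the union of the normal triangles, is its
   topological frontier in the pseudo-manifold. *)
Definition frontier (X : topologicalType) (A : set X) : set X :=
  closure A `\` A°.

Definition clamp01 (R : realType) (t : R) : R := Num.max 0 (Num.min t 1).

Definition edge_row (R : realType) (v w : 'I_4) (t : R) : 'rV[R]_4 :=
  \row_u ((1 - clamp01 t) * (u == v)%:R + clamp01 t * (u == w)%:R).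

Lemma edge_rowP (R : realType) (v w : 'I_4) (t : R) :
  edge_row v w t \in @simplex3_set R.
Proof.
have c0 : 0 <= clamp01 t by rewrite /clamp01 le_max lexx.
have c1 : clamp01 t <= 1 by rewrite /clamp01 ge_max ler01 ge_min lexx orbT.
apply/mem_set; split=> [u|].
  by rewrite mxE addr_ge0// mulr_ge0// subr_ge0.
have sum1 (a : 'I_4) : \sum_(u < 4) (u == a)%:R = 1 :> R.
  by rewrite (bigD1 a) //= eqxx big1 ?addr0 // => u /negPf ->.
under eq_bigr do rewrite mxE.
by rewrite big_split /= -!mulr_sumr !sum1 !mulr1 subrK.
Qed.

(* For 0 <= t <= 1, the point of the edge vw with coordinates 1 - t at v and
   t at w; [clamp01] only makes it total in t. *)
Definition edge_point (R : realType) (v w : 'I_4) (t : R) : simplex3 R :=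
  exist _ (edge_row v w t) (edge_rowP v w t).

Section Homotopy.
Variables (R : realType) (X : topologicalType).

Definition path_in (A : set X) (g : R -> X) : Prop :=
  {within `[0, 1], continuous g} /\ g @` `[0, 1] `<=` A.

Definition homotopic_rel_ends_in (C : set X) (g h : R -> X) : Prop :=
  exists H : R * R -> X,
    [/\ {within `[0, 1] `*` `[0, 1], continuous H},
        H @` (`[0, 1] `*` `[0, 1]) `<=` C,
        forall t, t \in `[0, 1] -> H (0, t) = g t /\ H (1, t) = h t
      & forall u, u \in `[0, 1] -> H (u, 0) = g 0 /\ H (u, 1) = g 1].

End Homotopy.

Section Essential.
Variables (R : realType) (n : nat) (T : triangulation n) (s : truncation R T).

(* The intersection with the core of the edge represented by edge vw of
   tetrahedron i, parametrised affinely by 0 <= t <= 1. *)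
Definition edge_arc (i : 'I_n) (v w : 'I_4) (t : R) : pseudo_manifold R T :=
  quot_map T i
    (edge_point v w ((1 - t) * cut s i v w + t * (1 - cut s i w v))).

(* By [cut_glue] all representatives of e give the same arc, up to reversal. *)
Definition essential (e : {set 'I_n * {set 'I_4}}) : Prop :=
  forall (i : 'I_n) (v w : 'I_4), v != w -> (i, [set v; w]%SET) \in e ->
    ~ exists h : R -> pseudo_manifold R T,
        path_in (frontier (core s)) h /\
        homotopic_rel_ends_in (core s) (edge_arc i v w) h.

End Essential.

(* Main.v *)
(* A point of the deformation variety prescribes the cross ratios with which to
   place each tetrahedron on the projective line, and a placement of a tetrahedron
   extends uniquely across each of its faces. The gluing equations say that going
   once around an edge brings a placement back to itself, so the pairs of a point
   and a placement of its tetrahedron form a covering of the pseudo-manifold minus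
   its vertices, and every homotopy in the core lifts. Suppose that the arc of an
   edge vw were homotopic into the boundary of the core. Along the lift of a path
   in the normal triangles, the ideal vertex cut off by the triangle is locally
   constant, hence constant; along the lift of the arc the placement is constant.
   So the placement would send v and w to the same point, but it is injective. *)

Require Import Defs.
From Stdlib Require Import Relation_Operators Operators_Properties.
From mathcomp Require Import all_boot all_order all_algebra all_fingroup.
From mathcomp Require Import all_classical all_reals all_analysis.
From mathcomp Require Import generic_quotient complex ring lra.
Import Order.TTheory GRing.Theory Num.Theory.
Import numFieldNormedType.Exports.

Set Implicit Arguments.
Unset Strict Implicit.
Unset Printing Implicit Defensive.

Local Open Scope classical_set_scope.
Local Open Scope ring_scope.

(** * Cross ratios *)

(** The covering is never formed as a space. Its points are represented by pairs of a tetrahedron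
    point and a placement, its open sets by predicates invariant under crossing a face, and
    placements are treated as discrete labels, so the shape parameters may lie in any field. The
    main obstacle is even covering near the edges. The gluing equation is a product over the whole
    class of an edge, whereas a development meets that class flag by flag. The two agree because a
    rotation about an edge meets each representative exactly once: orientation leaves only a flag
    and its flip over a given representative, and [glue_neq] excludes the flip. Lifts over the
    square are obtained by an induction along a segment, applied once in each direction. *)

Section ProjectiveLine.
Variable F : fieldType.
Implicit Types (a b c v w : option F) (z : F).

(** Homogeneous coordinates on the projective line, with [None] as the point at infinity. *)
Definition hom_x a : F := if a is Some x then x else 1.
Definition hom_y a : F := if a is Some _ then 1 else 0.
Definition pdet a b : F := hom_x a * hom_y b - hom_x b * hom_y a.

Lemma pdet_eq0 a b : (pdet a b == 0) = (a == b).
Proof.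
case: a b => [x|] [y|]; rewrite /pdet /= ?(mulr1, mulr0, mul1r) ?subr0 ?sub0r.
- by rewrite subr_eq0.
- by rewrite oppr_eq0 oner_eq0.
- by rewrite oner_eq0.
- by rewrite !eqxx.
Qed.

Lemma pdet_neq0 a b : a <> b -> pdet a b != 0.
Proof. by move=> ab; rewrite pdet_eq0; apply/eqP. Qed.

Lemma pdet_plucker a b v w :
  pdet a b * pdet v w = pdet a v * pdet b w - pdet a w * pdet b v.
Proof. by rewrite /pdet; ring. Qed.

(* [cross v w a z b]: in a coordinate that sends v to 0 and w to infinity,
   b is z times a. *)
Definition cross v w a z b : Prop :=
  pdet a w * pdet b v = z * (pdet a v * pdet b w).

Lemma cross1 v w a : cross v w a 1 a.
Proof. by rewrite /cross mul1r mulrC. Qed.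

Lemma cross_mul v w a y b z c : b <> v -> b <> w ->
  cross v w a y b -> cross v w b z c -> cross v w a (z * y) c.
Proof.
rewrite /cross => /pdet_neq0 bv /pdet_neq0 bw e1 e2.
apply: (mulfI (mulf_neq0 bv bw)).
have -> : pdet b v * pdet b w * (pdet a w * pdet c v)
  = (pdet a w * pdet b v) * (pdet b w * pdet c v) by ring.
by rewrite e1 e2; ring.
Qed.

Lemma cross_sym v w a z b : z != 0 -> cross v w a z b -> cross v w b z^-1 a.
Proof.
rewrite /cross => z0 e; apply: (mulfI z0).
by rewrite mulVKf // (mulrC (pdet b w)) -e mulrC.
Qed.

Lemma cross_inj v w a z b b' : z != 0 -> v <> w -> a <> v -> a <> w ->
  cross v w a z b -> cross v w a z b' -> b = b'.
Proof.
rewrite /cross => z0 /pdet_neq0 vw /pdet_neq0 av /pdet_neq0 aw e1 e2.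
apply/eqP; rewrite -pdet_eq0; apply/eqP/(mulIf vw).
rewrite mul0r pdet_plucker; apply/eqP; rewrite subr_eq0; apply/eqP.
apply: (mulfI (mulf_neq0 z0 (mulf_neq0 av aw))).
have -> : z * (pdet a v * pdet a w) * (pdet b v * pdet b' w)
  = (pdet a w * pdet b v) * (z * (pdet a v * pdet b' w)) by ring.
by rewrite -e2 e1; ring.
Qed.

Lemma hom_exists (x y : F) : (x != 0) || (y != 0) ->
  exists (a : option F) (t : F), [/\ t != 0, x = t * hom_x a & y = t * hom_y a].
Proof.
case: (eqVneq y 0) => [->|y0].
  by rewrite orbF => x0; exists None, x; rewrite mulr1 mulr0.
by move=> _; exists (Some (x / y)), y; rewrite /= mulr1 mulrC divfK.
Qed.

(** The determinants of the vector (x, y) below against v, w and a are nonzero multiples of z, 1 and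
    z - 1, which accounts for the three inequalities. *)
Lemma cross_exists v w a z : z != 0 -> z != 1 -> v <> w -> a <> v -> a <> w ->
  exists b, [/\ b <> v, b <> w, b <> a & cross v w a z b].
Proof.
move=> z0 z1 /pdet_neq0 vw /pdet_neq0 av /pdet_neq0 aw.
pose x := pdet a w * hom_x v - z * pdet a v * hom_x w.
pose y := pdet a w * hom_y v - z * pdet a v * hom_y w.
have det_v : x * hom_y v - hom_x v * y = z * pdet a v * pdet v w.
  by rewrite /x /y /pdet; ring.
have det_w : x * hom_y w - hom_x w * y = pdet a w * pdet v w.
  by rewrite /x /y /pdet; ring.
have det_a : x * hom_y a - hom_x a * y = (z - 1) * (pdet a v * pdet a w).
  by rewrite /x /y /pdet; ring.
have xy : (x != 0) || (y != 0).
  rewrite -negb_and; apply/negP => /andP[/eqP x0 /eqP y0].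
  by move/eqP: det_w; rewrite x0 y0 mul0r mulr0 subr0 eq_sym !mulf_eq0
    (negPf aw) (negPf vw).
have [b [t [t0 xE yE]]] := hom_exists xy.
have detE c : x * hom_y c - hom_x c * y = t * pdet b c.
  by rewrite xE yE /pdet; ring.
rewrite !detE in det_v det_w det_a.
have neq c d : t * pdet b c = d -> d != 0 -> b <> c.
  move=> dE d0 /eqP; rewrite -pdet_eq0 => /eqP bc.
  by move: d0; rewrite -dE bc mulr0 eqxx.
exists b; split.
- by apply: neq det_v _; rewrite !mulf_neq0.
- by apply: neq det_w _; rewrite !mulf_neq0.
- by apply: neq det_a _; rewrite !mulf_neq0 // subr_eq0.
- by apply: (mulfI t0); rewrite /cross mulrCA det_v
    (mulrCA t z) (mulrCA t (pdet a v)) det_w; ring.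
Qed.

End ProjectiveLine.

(** * Numberings of the four vertices and shape relations *)

Lemma ord4P (a : 'I_4) : [\/ a = 0, a = 1, a = 2 | a = 3].
Proof.
case: a => [[|[|[|[|k]]]] lt_a] //.
- by constructor 1; exact: val_inj.
- by constructor 2; exact: val_inj.
- by constructor 3; exact: val_inj.
- by constructor 4; exact: val_inj.
Qed.

Definition inv4 (a b c d : 'I_4) : bool :=
  (b < a)%N (+) (c < a)%N (+) (d < a)%N (+) (c < b)%N (+) (d < b)%N (+) (d < c)%N.

Lemma odd_perm4 (s : {perm 'I_4}) : odd_perm s = inv4 (s 0) (s 1) (s 2) (s 3).
Proof.
(* Two transpositions bring 0 and 1 back to their places; what remains is the identity or the
   exchange of 2 and 3, and a finite check. *)
pose t := (s * tperm (s 0%R) 0%R)%g; pose u := (t * tperm (t 1%R) 1%R)%g.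
have t0 : t 0 = 0 by rewrite permM tpermL.
have t1 : t 1 != 0 by rewrite -t0 (inj_eq perm_inj).
have u0 : u 0 = 0 by rewrite permM t0 tpermD.
have u1 : u 1 = 1 by rewrite permM tpermL.
have uE : u = if u 2 == 2 then 1%g else tperm 2 3.
  have u2 : u 2 = 2 \/ u 2 = 3.
    have : u 2 != 0 by rewrite -u0 (inj_eq perm_inj).
    have : u 2 != 1 by rewrite -[X in _ != X]u1 (inj_eq perm_inj).
    by have [->|->|->|->] := ord4P (u 2) => // *; [left|right].
  have u3 : [/\ u 3 != 0, u 3 != 1 & u 3 != u 2].
    split; first by rewrite -u0 (inj_eq perm_inj).
      by rewrite -[X in _ != X]u1 (inj_eq perm_inj).
    by rewrite (inj_eq perm_inj).
  apply/permP => x; case: u2 u3 => u2; rewrite u2 => -[];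
  have [u3|u3|u3|u3] := ord4P (u 3); rewrite u3 // => _ _ _ /=;
  have [->|->|->|->] := ord4P x; rewrite ?u0 ?u1 ?u2 ?u3 ?perm1 ?permE //=.
have sE : s = (u * tperm (t 1%R) 1%R * tperm (s 0%R) 0%R)%g.
  by rewrite /u /t -!mulgA (mulgA (tperm _ 1)) tperm2 mul1g tperm2 mulg1.
move: uE sE t1; move: (u 2 == 2) (t 1) (s 0) => b x y -> -> x0.
rewrite !odd_permM !odd_tperm !permM.
have [xE|xE|xE|xE] := ord4P x; have [yE|yE|yE|yE] := ord4P y;
  rewrite {}xE {}yE // in x0 *; case: b;
  by rewrite ?perm1 ?odd_perm1 ?odd_tperm ?permE /= ?permE /= ?permE /=.
Qed.

(* The label 0, 1, 2 (for z, z', z'') of the edge ab of the standard simplex: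
   the edges labelled z' are those with a + b = 3. *)
Definition edge_label (a b : 'I_4) : 'I_3 :=
  if (a + b == 3)%N then 1 else if odd (a + b) then 0 else 2.

Section ShapeRelations.
Variables (F : fieldType) (z : 'I_3 -> F).
Hypotheses (z02 : z 0 * (1 - z 2) = 1) (z10 : z 1 * (1 - z 0) = 1)
           (z21 : z 2 * (1 - z 1) = 1).

Lemma shape_neq01 k : z k != 0 /\ z k != 1.
Proof.
have aux (a b : F) : a * (1 - b) = 1 -> a != 0 /\ b != 1.
  move=> ab; have : a * (1 - b) != 0 by rewrite ab oner_neq0.
  by rewrite mulf_eq0 negb_or subr_eq0 (eq_sym 1) => /andP[].
have [? ?] := aux _ _ z02; have [? ?] := aux _ _ z10; have [? ?] := aux _ _ z21.
by case: k => [[|[|[|k]]] lt_k] //; split;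
  [rewrite (_ : Ordinal _ = 0)| rewrite (_ : Ordinal _ = 0)
  |rewrite (_ : Ordinal _ = 1)| rewrite (_ : Ordinal _ = 1)
  |rewrite (_ : Ordinal _ = 2)| rewrite (_ : Ordinal _ = 2)] => //; apply: val_inj.
Qed.

(** The cross-ratio equation at an edge labelled k, in terms of the three products related by the
    Plucker identity X = Y - W. *)
Let rel (Q : 'I_4 -> option F) (k : 'I_3) : Prop :=
  let X := pdet (Q 0) (Q 1) * pdet (Q 2) (Q 3) in
  let Y := pdet (Q 0) (Q 2) * pdet (Q 1) (Q 3) in
  let W := pdet (Q 0) (Q 3) * pdet (Q 1) (Q 2) in
  if k == 0 then W = z 0 * Y else if k == 1 then Y = z 1 * X else - X = z 2 * W.

Let rel_all Q k l : rel Q k -> rel Q l.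
Proof.
rewrite /rel; have := pdet_plucker (Q 0) (Q 1) (Q 2) (Q 3).
set X := pdet _ _ * _; set Y := pdet _ _ * _; set W := pdet _ _ * _ => XYW.
have r01 : W = z 0 * Y -> Y = z 1 * X.
  move=> e; rewrite XYW e -[LHS]mul1r -z10; ring.
have r12 : Y = z 1 * X -> - X = z 2 * W.
  move=> e; have -> : W = Y - X by rewrite XYW; ring.
  by rewrite e -[X in - X = _]mul1r -z21; ring.
have r20 : - X = z 2 * W -> W = z 0 * Y.
  move=> e; have -> : Y = X + W by rewrite XYW; ring.
  by rewrite -[X in X + _]opprK e -[LHS]mul1r -z02; ring.
by case: ifP => _; [|case: ifP => _]; (case: ifP => _; [|case: ifP => _]); auto.
Qed.

(** By the Plucker identity and the parameter relations, the equation for z gives the one for z',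
    that one gives z'', and z'' gives z again. So checking one even numbering checks all twelve. *)
Lemma cross_even (Q : 'I_4 -> option F) (s t : {perm 'I_4}) :
    ~~ odd_perm s -> ~~ odd_perm t ->
  cross (Q (s 0)) (Q (s 1)) (Q (s 2)) (z (edge_label (s 0) (s 1))) (Q (s 3)) ->
  cross (Q (t 0)) (Q (t 1)) (Q (t 2)) (z (edge_label (t 0) (t 1))) (Q (t 3)).
Proof.
have crossE u : ~~ odd_perm u ->
    cross (Q (u 0)) (Q (u 1)) (Q (u 2)) (z (edge_label (u 0) (u 1))) (Q (u 3)) <->
    rel Q (edge_label (u 0) (u 1)).
  have u01 : u 0 != u 1 by rewrite (inj_eq perm_inj).
  have u02 : u 0 != u 2 by rewrite (inj_eq perm_inj).
  have u03 : u 0 != u 3 by rewrite (inj_eq perm_inj).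
  have u12 : u 1 != u 2 by rewrite (inj_eq perm_inj).
  have u13 : u 1 != u 3 by rewrite (inj_eq perm_inj).
  have u23 : u 2 != u 3 by rewrite (inj_eq perm_inj).
  rewrite odd_perm4; move: (u 0) (u 1) (u 2) (u 3) u01 u02 u03 u12 u13 u23.
  move=> a b c d.
  (* In every even numbering the differences of the two sides of [cross] and of [rel] agree up to
     sign. *)
  have eqN (x x' y y' : F) : x - y = x' - y' \/ x - y = y' - x' -> x = y <-> x' = y'.
    move=> xy; suff E : (x == y) = (x' == y').
      by split=> /eqP e; apply/eqP; rewrite ?E // -E.
    by rewrite -subr_eq0 -[RHS]subr_eq0; case: xy => -> //; rewrite !subr_eq0 eq_sym.
  have [->|->|->|->] := ord4P a; have [->|->|->|->] := ord4P b => //;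
  have [->|->|->|->] := ord4P c => //; have [->|->|->|->] := ord4P d => // *;
  rewrite /cross /rel /edge_label /=; apply: eqN; rewrite /pdet;
  ((by left; ring) || (right; ring)).
by move=> /crossE s_even /crossE t_even /s_even /rel_all rt; exact/t_even.
Qed.

End ShapeRelations.

Lemma eq_set2 (a b c d : 'I_4) : a != b ->
  ([set a; b]%SET == [set c; d]%SET) = (a == c) && (b == d) || (a == d) && (b == c).
Proof.
move=> ab; apply/eqP/orP => [e|[]/andP[/eqP -> /eqP ->] //]; last first.
  by rewrite finset.setUC.
have : a \in [set c; d]%SET by rewrite -e !inE eqxx.
have : b \in [set c; d]%SET by rewrite -e !inE eqxx orbT.
rewrite !inE => /orP[]/eqP bE /orP[]/eqP aE; move: ab; rewrite aE bE ?eqxx //;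
  by [left|right].
Qed.

Lemma label_edgesE (k : 'I_3) (a b : 'I_4) : a != b ->
  ([set a; b]%SET \in label_edges k) = (k == edge_label a b).
Proof.
move=> ab; rewrite /label_edges.
have k012 : [\/ k = 0, k = 1 | k = 2].
  case: k => [[|[|[|k]]] lt_k] //.
  - by constructor 1; exact: val_inj.
  - by constructor 2; exact: val_inj.
  - by constructor 3; exact: val_inj.
case: k012 => -> /=; rewrite !inE !eq_set2 //;
by have [aE|aE|aE|aE] := ord4P a; have [bE|bE|bE|bE] := ord4P b;
  rewrite aE bE in ab *.
Qed.

Lemma perm_ext4 (s t : {perm 'I_4}) :
  s 0 = t 0 -> s 1 = t 1 -> s 2 = t 2 -> s 3 = t 3 -> s = t.
Proof. by move=> *; apply/permP => x; case: (ord4P x) => ->. Qed.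

Lemma perm4_onto (s : {perm 'I_4}) (a : 'I_4) :
  [\/ a = s 0, a = s 1, a = s 2 | a = s 3].
Proof.
by rewrite -[a](permKV s); case: (ord4P ((s^-1)%g a)) => ->;
  [constructor 1|constructor 2|constructor 3|constructor 4].
Qed.

Lemma perm4_neq (s : {perm 'I_4}) (a b : 'I_4) : a != b -> s a <> s b.
Proof. by move=> ab /perm_inj /eqP; apply/negP. Qed.

Definition flip_perm : {perm 'I_4} := (tperm 0%R 1%R * tperm 2%R 3%R)%g.

Lemma flip_permE : [/\ flip_perm 0 = 1, flip_perm 1 = 0,
  flip_perm 2 = 3 & flip_perm 3 = 2].
Proof. by rewrite /flip_perm !permM !permE /=; split. Qed.

Lemma flip_permK : (flip_perm * flip_perm = 1)%g.
Proof.
have [f0 f1 f2 f3] := flip_permE.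
by apply: perm_ext4; rewrite permM perm1 ?f0 ?f1 ?f2 ?f3 ?f0 ?f1 ?f2 ?f3.
Qed.

(** An even permutation preserving {0, 1} also preserves {2, 3}, and it exchanges both pairs or
    neither. *)
Lemma perm4_same_pair (p q : {perm 'I_4}) : odd_perm p = odd_perm q ->
  [set p 0; p 1]%SET = [set q 0; q 1]%SET -> p = q \/ p = (flip_perm * q)%g.
Proof.
move=> pq pq01; pose r := (p * q^-1)%g.
have -> : p = (r * q)%g by rewrite /r mulgKV.
have r_even : ~~ odd_perm r by rewrite odd_permM odd_permV pq addbb.
have r01 k : k \in [set 0; 1]%SET -> r k \in [set 0; 1]%SET.
  move=> k01; have : p k \in [set q 0; q 1]%SET.
    by rewrite -pq01; move: k01; rewrite !inE => /orP[]/eqP ->; rewrite eqxx ?orbT.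
  by rewrite permM !inE => /orP[]/eqP ->; rewrite permK eqxx ?orbT.
have := r01 0; have := r01 1; rewrite !inE /= => /(_ isT) r1 /(_ isT) r0.
suff : r = 1%g \/ r = flip_perm by case=> ->; [left; rewrite mul1g|right].
have [f0 f1 f2 f3] := flip_permE.
have : r 0 != r 1 by rewrite (inj_eq perm_inj).
have : r 0 != r 2 by rewrite (inj_eq perm_inj).
have : r 0 != r 3 by rewrite (inj_eq perm_inj).
have : r 1 != r 2 by rewrite (inj_eq perm_inj).
have : r 1 != r 3 by rewrite (inj_eq perm_inj).
have : r 2 != r 3 by rewrite (inj_eq perm_inj).
move: r_even; rewrite odd_perm4.
case/orP: r0 => /eqP r0; case/orP: r1 => /eqP r1;
have [r2|r2|r2|r2] := ord4P (r 2); have [r3|r3|r3|r3] := ord4P (r 3);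
rewrite ?r0 ?r1 ?r2 ?r3 // => *;
by [left; apply: perm_ext4; rewrite ?perm1 |
    right; apply: perm_ext4; rewrite ?f0 ?f1 ?f2 ?f3].
Qed.

Lemma perm4_exists (a b : 'I_4) (odd : bool) : a != b ->
  exists p : {perm 'I_4}, [/\ p 0 = a, p 1 = b & odd_perm p = odd].
Proof.
(* The vertex c is the one that [tperm 0 a] sends to b. Exchanging 2 and 3 beforehand corrects the
   parity without moving the images of 0 and 1. *)
move=> ab; pose c := tperm 0 a b; pose q := (tperm 1%R c * tperm 0%R a)%g.
have c0 : c != 0.
  by rewrite -(tpermR 0 a) (inj_eq perm_inj) eq_sym.
have q0 : q 0 = a by rewrite permM (@tpermD _ 1 c) // tpermL.
have q1 : q 1 = b by rewrite permM tpermL tpermK.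
exists (if odd_perm q == odd then q else tperm 2%R 3%R * q)%g.
case: eqP => [q_odd|/eqP q_odd]; first by split.
rewrite (permM _ q 0) (permM _ q 1) !(@tpermD _ 2 3) // q0 q1; split=> //.
by rewrite odd_permM odd_tperm; case: odd_perm odd q_odd => [] [].
Qed.

Lemma perm4_exists3 (a : 'I_4) (odd : bool) :
  exists p : {perm 'I_4}, p 3 = a /\ odd_perm p = odd.
Proof.
pose q := tperm 3 a; exists (if odd_perm q == odd then q else tperm 0%R 1%R * q)%g.
case: eqP => [q_odd|/eqP q_odd]; first by rewrite tpermL.
rewrite permM (@tpermD _ 0 1) // tpermL; split=> //.
by rewrite odd_permM odd_tperm; case: odd_perm odd q_odd => [] [].
Qed.

(** * Turning around an edge *)

Section Turning.
Variables (n : nat) (T : triangulation n).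

(* A flag (i, p) lists the vertices p 0, p 1, p 2, p 3 of tetrahedron i; turning
   it rotates about the edge spanned by p 0 and p 1, across the face opposite
   p 2. *)
Definition flag : finType := ('I_n * {perm 'I_4})%type.

Definition turn (x : flag) : flag :=
  (glue_tet T x.1 (x.2 2),
   (tperm 2%R 3%R * x.2 * glue_perm T x.1 (x.2 2%R))%g).

Definition flip (x : flag) : flag := (x.1, (flip_perm * x.2)%g).

Lemma turnE (x : flag) (g := glue_perm T x.1 (x.2 2)) :
  [/\ (turn x).2 0 = g (x.2 0), (turn x).2 1 = g (x.2 1),
      (turn x).2 2 = g (x.2 3) & (turn x).2 3 = g (x.2 2)].
Proof. by split; rewrite !permM ?tpermL ?tpermR //= !(@tpermD _ 2 3). Qed.

Lemma flipE (x : flag) :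
  [/\ (flip x).2 0 = x.2 1, (flip x).2 1 = x.2 0,
      (flip x).2 2 = x.2 3 & (flip x).2 3 = x.2 2].
Proof. by have [f0 f1 f2 f3] := flip_permE; split; rewrite permM; congr (x.2 _). Qed.

Lemma flipK : involutive flip.
Proof. by case=> i p; rewrite /flip /= mulgA flip_permK mul1g. Qed.

(** Seen from the other end of the edge the rotation runs backwards: [flip] conjugates [turn] to its
    inverse. *)
Lemma turn_flip x : turn (flip (turn x)) = flip x.
Proof.
have [t0 t1 t2 t3] := turnE x.
have [f0 f1 f2 f3] := flipE (turn x).
have gK := glue_permK T x.1 (x.2 2).
rewrite [LHS]surjective_pairing [RHS]surjective_pairing; congr pair.
  by rewrite /= f2 t3 glue_tetK.
have [h0 h1 h2 h3] := turnE (flip (turn x)).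
have [e0 e1 e2 e3] := flipE x.
by apply: perm_ext4;
  rewrite ?h0 ?h1 ?h2 ?h3 f2 t3 gK ?f0 ?f1 ?f2 ?f3 ?t0 ?t1 ?t2 ?t3 permK.
Qed.

Lemma turn_inj : injective turn.
Proof.
move=> x y e; apply: (inv_inj flipK).
by rewrite -(turn_flip x) -(turn_flip y) e.
Qed.

(* If k turns flip an edge, so do k - 2 turns of the next flag; a single turn
   cannot, since no face is glued to itself. *)
Lemma iter_turn_neq_flip k x : iter k turn x <> flip x.
Proof.
elim/ltn_ind: k x => -[|[|k]] IH x.
- case: x => i p e; have := flipE (i, p); rewrite -e => -[/= + _ _ _].
  by apply: perm4_neq.
- move=> /= e; have := glue_neq T x.1 (x.2 2).
  have [_ _ _ <-] := turnE x; rewrite e; have [_ _ _ ->] := flipE x.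
  by rewrite -[glue_tet T x.1 (x.2 2)]/(turn x).1 e eqxx.
- rewrite iterS iterSr -turn_flip => /turn_inj.
  exact: IH.
Qed.

Variable o : 'I_n -> bool.
Hypothesis To : oriented T o.

Definition positive (x : flag) : Prop := odd_perm x.2 = o x.1.

Lemma turn_positive x : positive x -> positive (turn x).
Proof.
rewrite /positive /= !odd_permM odd_tperm => ->.
by rewrite To; case: (o _) (o _) => [] [].
Qed.

Lemma orbit_positive x y : positive x -> fconnect turn x y -> positive y.
Proof.
move=> x_pos /iter_findex <-.
by elim: (findex _ _ _) => //= k; apply: turn_positive.
Qed.

(** Two positive flags at the same edge of the same tetrahedron are equal or flips of each other,
    and [iter_turn_neq_flip] excludes a flip within an orbit. *)
Lemma orbit_edge_inj x y : positive x -> fconnect turn x y ->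
  x.1 = y.1 -> [set x.2 0; x.2 1]%SET = [set y.2 0; y.2 1]%SET -> x = y.
Proof.
move=> x_pos xy x1 x01; have y_pos := orbit_positive x_pos xy.
have x2 : odd_perm y.2 = odd_perm x.2 by rewrite x_pos y_pos x1.
have [e|e] := perm4_same_pair x2 (esym x01).
  by rewrite [x]surjective_pairing x1 -e -surjective_pairing.
case: (@iter_turn_neq_flip (findex turn x y) x).
by rewrite iter_findex // [y]surjective_pairing -x1 e.
Qed.

Definition flag_edge (x : flag) : 'I_n * {set 'I_4} :=
  (x.1, [set x.2 0; x.2 1]%SET).

Lemma glued_edges_turn x : glued_edges T (flag_edge x) (flag_edge (turn x)).
Proof.
apply/existsP; exists (x.2 2); have [t0 t1 _ _] := turnE x.
rewrite /flag_edge /= !inE !(inj_eq perm_inj) /=.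
by rewrite imsetU1 imset_set1 t0 t1.
Qed.

Definition turn_back (x : flag) : flag := flip (turn (flip x)).

Lemma turn_backK x : turn (turn_back x) = x.
Proof. by rewrite turn_flip flipK. Qed.

Lemma fconnect_turn_back x y : fconnect turn x y -> fconnect turn x (turn_back y).
Proof.
by move=> xy; apply: connect_trans xy _; rewrite (fconnect_sym turn_inj)
  -{2}[y]turn_backK fconnect1.
Qed.

Lemma turn_backE (x : flag) (g := glue_perm T x.1 (x.2 3)) :
  [/\ (turn_back x).1 = glue_tet T x.1 (x.2 3),
      (turn_back x).2 0 = g (x.2 0), (turn_back x).2 1 = g (x.2 1),
      (turn_back x).2 2 = g (x.2 3) & (turn_back x).2 3 = g (x.2 2)].
Proof.
have [f0 f1 f2 f3] := flipE x; have [t0 t1 t2 t3] := turnE (flip x).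
have [e0 e1 e2 e3] := flipE (turn (flip x)).
split; first by rewrite -f2.
all: by rewrite ?e0 ?e1 ?e2 ?e3 ?t0 ?t1 ?t2 ?t3 ?f0 ?f1 ?f2 ?f3.
Qed.

End Turning.

(** * Placements and holonomy *)

Section Placements.
Variables (F : fieldType) (n : nat) (T : triangulation n) (o : 'I_n -> bool).
Variables (f : 'I_n -> {perm 'I_4}) (Z : 'M[F]_(n, 3)).
Hypothesis To : oriented T o.
Hypothesis fo : orientation_preserving o f.
Hypothesis Zrel : forall i, [/\ Z i 0 * (1 - Z i 2) = 1,
  Z i 1 * (1 - Z i 0) = 1 & Z i 2 * (1 - Z i 1) = 1].
Hypothesis Zglue : forall e, e \in edges T ->
  \prod_(i < n) (Z i 0 ^+ incidence f i e 0 * Z i 1 ^+ incidence f i e 1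
                 * Z i 2 ^+ incidence f i e 2) = 1.

Implicit Types (P Q : 'I_4 -> option F) (x y : flag n).

Definition shape x : F :=
  Z x.1 (edge_label ((f x.1)^-1%g (x.2 0)) ((f x.1)^-1%g (x.2 1))).

Lemma shape_neq0 x : shape x != 0.
Proof. by have [r0 r1 r2] := Zrel x.1; apply: (shape_neq01 r0 r1 r2 _).1. Qed.

Lemma shape_neq1 x : shape x != 1.
Proof. by have [r0 r1 r2] := Zrel x.1; apply: (shape_neq01 r0 r1 r2 _).2. Qed.

(* A placement of tetrahedron i sends its vertices to four distinct points of
   the projective line whose cross ratios are the shape parameters. *)
Definition placement i P : Prop := injective P /\
  forall p, positive o (i, p) ->
    cross (P (p 0)) (P (p 1)) (P (p 2)) (shape (i, p)) (P (p 3)).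

Lemma placement_uniq i P Q u : placement i P -> placement i Q ->
  (forall v, v != u -> P v = Q v) -> P = Q.
Proof.
move=> [P_inj Pcr] [_ Qcr] PQ.
have [p [p3 p_pos]] := perm4_exists3 u (o i).
have pu k : k != 3 -> p k != u by rewrite -p3 (inj_eq perm_inj).
have neq (a b : 'I_4) : a != b -> P (p a) <> P (p b).
  by move=> ab /P_inj; apply: perm4_neq.
apply/funext => v; have [->|vu] := eqVneq v u; last exact: PQ.
rewrite -p3; apply: (cross_inj (shape_neq0 (i, p)) (neq 0 1 isT) (neq 2 0 isT)
  (neq 2 1 isT) (Pcr _ p_pos)).
by have := Qcr _ p_pos; rewrite -(PQ (p 0)) -?(PQ (p 1)) -?(PQ (p 2)) ?pu.
Qed.

(** One positive numbering ending with u gives an equation that [cross_exists] solves for the image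
    of u; [cross_even] then yields the equations of all other positive numberings. *)
Lemma placement_fill i u Q : (forall v w, v != u -> w != u -> Q v = Q w -> v = w) ->
  exists2 P, placement i P & forall v, v != u -> P v = Q v.
Proof.
move=> Q_inj; have [p [p3 p_pos]] := perm4_exists3 u (o i).
have pu k : k != 3 -> p k != u by rewrite -p3 (inj_eq perm_inj).
have neq (a b : 'I_4) : a != 3 -> b != 3 -> a != b -> Q (p a) <> Q (p b).
  by move=> a3 b3 ab /(Q_inj _ _ (pu _ a3) (pu _ b3)); apply: perm4_neq.
have [b [b0 b1 b2 bcr]] := cross_exists (shape_neq0 (i, p)) (shape_neq1 (i, p))
  (neq 0 1 isT isT isT) (neq 2 0 isT isT isT) (neq 2 1 isT isT isT).
pose P v := if v == u then b else Q v.
have Pu : P u = b by rewrite /P eqxx.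
have PQ v : v != u -> P v = Q v by rewrite /P => /negPf ->.
have b_neq v : v != u -> Q v <> b.
  case: (perm4_onto p v) => -> // => [_|_|_|]; [exact/nesym|exact/nesym|exact/nesym|].
  by rewrite p3 eqxx.
exists P => //; split.
  move=> v w; have [->|vu] := eqVneq v u; have [->|wu] := eqVneq w u => //.
  - by rewrite Pu PQ // => /esym e; case: (b_neq w wu).
  - by rewrite Pu PQ // => e; case: (b_neq v vu).
  - by rewrite !PQ //; apply: Q_inj.
move=> q q_pos; have [r0 r1 r2] := Zrel i.
have even (r : {perm 'I_4}) : odd_perm r = o i -> ~~ odd_perm (r * (f i)^-1)%g.
  by move=> ro; rewrite odd_permM odd_permV fo ro addbb.
have := cross_even r0 r1 r2 (Q := P \o f i) (even _ p_pos) (even _ q_pos).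
rewrite /= !permM !permKV p3 Pu !(PQ (p _)) ?pu // => cr; exact: cr.
Qed.

Lemma placement_exists i : exists P, placement i P.
Proof.
pose Q (v : 'I_4) : option F :=
  if v == 0 then None else if v == 1 then Some 0 else Some 1.
have [|P] := @placement_fill i 3 Q; last by exists P.
move=> v w; rewrite /Q; case: (ord4P v) => ->; case: (ord4P w) => -> //= _ _ [] /eqP;
  by rewrite ?oner_eq0 // eq_sym oner_eq0.
Qed.

Definition neighbour i P u Q : Prop := placement (glue_tet T i u) Q /\
  forall v, v != u -> Q (glue_perm T i u v) = P v.

Lemma neighbour_exists i P u : placement i P -> exists Q, neighbour i P u Q.
Proof.
move=> [P_inj _]; set g := glue_perm T i u.
have [|Q pQ PQ] := @placement_fill (glue_tet T i u) (g u) (fun v => P (g^-1%g v)).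
  by move=> v w _ _ /P_inj /perm_inj.
exists Q; split=> // v vu; rewrite PQ ?permK // (inj_eq perm_inj) //.
Qed.

Lemma neighbour_sym i P u Q : placement i P -> neighbour i P u Q ->
  neighbour (glue_tet T i u) Q (glue_perm T i u u) P.
Proof.
move=> pP [_ PQ]; split; rewrite ?glue_tetK // glue_permK => v vu.
rewrite -[in RHS](permKV (glue_perm T i u) v) PQ //.
by apply: contraNneq vu => e; rewrite -[v](permKV (glue_perm T i u)) e.
Qed.

(** The parameter of the edge A. Written as a product over labels it is 1 on sets that are not
    edges, so [glue_product] can exchange products over all sets. *)
Definition label_param i (A : {set 'I_4}) : F :=
  \prod_(k | A \in label_edges k) Z i k.

Lemma label_paramE i (a b : 'I_4) : a != b ->
  label_param i [set a; b]%SET = Z i (edge_label a b).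
Proof.
move=> ab; rewrite /label_param (eq_bigl (pred1 (edge_label a b))).
  by rewrite big_pred1_eq.
by move=> k; rewrite /= label_edgesE.
Qed.

Lemma glue_product e :
  \prod_(i < n) (Z i 0 ^+ incidence f i e 0 * Z i 1 ^+ incidence f i e 1
                 * Z i 2 ^+ incidence f i e 2)
  = \prod_(b in e) label_param b.1 ((f b.1)^-1%g @: b.2).
Proof.
transitivity (\prod_i \prod_(A : {set 'I_4} | (i, f i @: A) \in e) label_param i A).
  apply: eq_bigr => i _.
  transitivity (\prod_(k < 3) Z i k ^+ incidence f i e k).
    rewrite !big_ord_recl big_ord0 mulr1 mulrA.
    by congr (_ * _ * _); congr (Z i _ ^+ incidence f i e _); exact: val_inj.
  rewrite /label_param (exchange_big_dep predT) //=; apply: eq_bigr => k _.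
  rewrite prodr_const; congr (_ ^+ _); apply: eq_card => A.
  by rewrite !inE andbC.
rewrite pair_big_dep /=.
have fK (s : {perm 'I_4}) (A : {set 'I_4}) : s @: (s^-1%g @: A) = A.
  rewrite -imset_comp -[RHS]imset_id; apply: eq_imset => v /=.
  exact: permKV.
have fKV (s : {perm 'I_4}) (A : {set 'I_4}) : s^-1%g @: (s @: A) = A.
  by rewrite -{2}[s]invgK fK.
rewrite (reindex (fun b : 'I_n * {set 'I_4} => (b.1, (f b.1)^-1%g @: b.2))) /=.
  by apply: eq_bigl => -[i A] /=; rewrite fK.
exists (fun b : 'I_n * {set 'I_4} => (b.1, f b.1 @: b.2)) => -[i A] _ /=.
  by rewrite fK.
by rewrite fKV.
Qed.

(** The only faces containing the edge of a flag are those opposite its third and fourth vertices,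
    so each move within the class is a [turn] or a [turn_back]. *)
Lemma edge_class x : positive o x ->
  @flag_edge n @: [set y | fconnect (turn T) x y]%SET
  = [set b | connect (glued_edges T) (flag_edge x) b]%SET.
Proof.
move=> x_pos; apply/setP => b; rewrite inE; apply/imsetP/idP => [[y]|].
  rewrite inE => xy ->; rewrite -(iter_findex xy).
  elim: (findex _ _ _) => [|k IH] //=.
  by apply: connect_trans IH _; apply: connect1; apply: glued_edges_turn.
move=> /connectP[s + ->]; elim/last_ind: s => [|s c IH].
  by exists x; rewrite // inE connect0.
rewrite rcons_path last_rcons => /andP[/IH[y]]; rewrite inE => xy -> .
move=> /existsP[u /andP[]] /=; rewrite !inE negb_or => /andP[u0 u1] /eqP ->.
have [uE|uE] : u = y.2 2 \/ u = y.2 3.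
  by case: (perm4_onto y.2 u) u0 u1 => ->; rewrite ?eqxx //; [left|right].
- exists (turn T y); first by rewrite inE (connect_trans xy) // fconnect1.
  have [t0 t1 _ _] := turnE T y.
  by rewrite /flag_edge t0 t1 uE imsetU1 imset_set1.
- exists (turn_back T y); first by rewrite inE fconnect_turn_back.
  have [t t0 t1 _ _] := turn_backE T y.
  by rewrite /flag_edge t t0 t1 uE imsetU1 imset_set1.
Qed.

(** By [edge_class] and [orbit_edge_inj] the flags of the orbit correspond one to one to the edges
    in the class, so the gluing equation can be read along the orbit. *)
Lemma orbit_product x : positive o x ->
  \prod_(k < fingraph.order (turn T) x) shape (iter k (turn T) x) = 1.
Proof.
move=> x_pos.
have e_edge : [set b | connect (glued_edges T) (flag_edge x) b]%SET \in edges T.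
  apply/imsetP; exists (flag_edge x) => //.
  by rewrite inE cards2 (inj_eq perm_inj).
rewrite -[RHS](Zglue e_edge) glue_product -edge_class // big_imset /=; last first.
  move=> y z; rewrite !inE => xy xz /eqP; rewrite xpair_eqE => /andP[/eqP yz1 /eqP yz2].
  apply: (@orbit_edge_inj n T o) yz2 => //; first exact: orbit_positive xy.
  by apply: connect_trans xz; rewrite fconnect_sym //; apply: turn_inj.
rewrite (eq_bigr shape); last first.
  move=> y _; rewrite /= imsetU1 imset_set1 label_paramE //.
  by rewrite !(inj_eq perm_inj).
rewrite (eq_bigl (mem (fingraph.orbit (turn T) x))); last first.
  by move=> y; rewrite inE fconnect_orbit.
rewrite -big_uniq ?fingraph.orbit_uniq //= /fingraph.orbit.
rewrite (big_nth x) size_traject big_mkord.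
by apply: eq_bigr => k _; rewrite nth_traject.
Qed.

(* In the coordinate of [cross] at the edge of x, the third vertex of y is this
   multiple of the third vertex of x when tetrahedra are developed around the
   edge. *)
Definition turn_ratio x y : F :=
  \prod_(k < findex (turn T) x y) shape (iter k (turn T) x).

Lemma turn_ratioS x y : positive o x -> fconnect (turn T) x y ->
  turn_ratio x (turn T y) = shape y * turn_ratio x y.
Proof.
move=> x_pos xy; have := findex_max xy.
rewrite leq_eqVlt /turn_ratio => /orP[/eqP|] lt_k.
  (* The turn that closes the orbit: the index falls back to 0, and the full product is 1 by the
     gluing equation. *)
  have -> : turn T y = x.
    by rewrite -{1}(iter_findex xy) -iterS lt_k iter_order //; apply: turn_inj.
  rewrite findex0 big_ord0 -[LHS](orbit_product x_pos) -lt_k big_ord_recr /=.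
  by rewrite iter_findex // mulrC.
have -> : findex (turn T) x (turn T y) = (findex (turn T) x y).+1.
  by rewrite -{1}(iter_findex xy) -iterS findex_iter.
rewrite big_ord_recr /=.
by rewrite iter_findex // mulrC.
Qed.

Lemma turn_ratio_refl x : turn_ratio x x = 1.
Proof. by rewrite /turn_ratio findex0 big_ord0. Qed.

(** In (i, B, P) the set B marks the cell about which tetrahedron i, placed by P, is developed: an
    edge, a face or the whole tetrahedron when B has two, three or four elements. *)
Definition pstate : Type := ('I_n * {set 'I_4} * ('I_4 -> option F))%type.

(* One step of development across a face containing the marked vertices B. *)
Definition dstep (s t : pstate) : Prop := exists u,
  [/\ u \notin s.1.2,
      t.1 = (glue_tet T s.1.1 u, glue_perm T s.1.1 u @: s.1.2)%SET,
      placement s.1.1 s.2 & neighbour s.1.1 s.2 u t.2].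

Definition dwalk : pstate -> pstate -> Prop := clos_refl_trans _ dstep.

Lemma dstep_sym s t : dstep s t -> dstep t s.
Proof.
case: s t => [[i B] P] [[j B'] Q] [u [/= uB [-> ->] pP PQ]].
have [pQ _] := PQ.
exists (glue_perm T i u u); split => //=.
- by rewrite mem_imset //; apply: perm_inj.
- rewrite glue_tetK glue_permK; congr pair.
  rewrite -imset_comp -[LHS]imset_id; apply: eq_imset => v /=.
  by rewrite permK.
- exact: neighbour_sym.
Qed.

Lemma dwalk_sym s t : dwalk s t -> dwalk t s.
Proof.
elim=> [s' t' st|s'|s' t' u' _ IH1 _ IH2].
- by apply: rt_step; apply: dstep_sym.
- exact: rt_refl.
- exact: rt_trans IH2 IH1.
Qed.

Lemma dwalk_card s t : dwalk s t -> #|s.1.2| = #|t.1.2|.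
Proof.
elim=> [[[i B] P] [[j B'] Q] [u [/= _ [_ ->] _ _]]|//|s' t' u' _ -> //].
by rewrite card_imset //; apply: perm_inj.
Qed.

Lemma dwalk_placement s t : dwalk s t -> placement s.1.1 s.2 -> placement t.1.1 t.2.
Proof.
elim=> [[[i B] P] [[j B'] Q] [u [/= _ [-> _] _ []]]|//|s' t' u' _ IH1 _ IH2 /IH1 /IH2 //].
by [].
Qed.

Lemma dwalk_lift s t P : dwalk s t -> placement s.1.1 P ->
  exists2 Q, placement t.1.1 Q & dwalk (s.1, P) (t.1, Q).
Proof.
move=> st.
elim: st P => [[[i B] P'] [[j B'] Q'] [u [/= uB e _ _]]|s'|s' t' u' _ IH1 _ IH2] P pP.
- have [Q PQ] := neighbour_exists u pP.
  exists Q; first by move: PQ; case: e => -> _ [].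
  by apply: rt_step; exists u.
- by exists P => //; apply: rt_refl.
- have [Q pQ st] := IH1 _ pP; have [Q' pQ' tu] := IH2 _ pQ.
  by exists Q' => //; apply: rt_trans st tu.
Qed.

Lemma dwalk_inv (I : pstate -> Prop) s t :
    (forall s' t', dwalk s s' -> I s' -> dstep s' t' -> I t') ->
  I s -> dwalk s t -> I t.
Proof.
move=> I_step Is st; have {st} := clos_rt_rtn1 _ _ _ _ st.
by elim=> // s' t' st ss' IH; apply: I_step (clos_rtn1_rt _ _ _ _ ss') IH st.
Qed.

(** At most one face contains B, so a walk only goes back and forth across it. Being one step away
    cannot mean being back at (i, B), since then the face would be glued to itself. *)
Lemma holonomy_face i (B : {set 'I_4}) P P' : (2 < #|B|)%N -> placement i P ->
  dwalk (i, B, P) (i, B, P') -> P = P'.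
Proof.
move=> B3 pP walk.
have B_codim s u v : dwalk (i, B, P) s -> u \notin s.1.2 -> v \notin s.1.2 -> u = v.
  move=> /dwalk_card /= sB; rewrite -!finset.in_setC => us vs; apply/eqP.
  have : (#|~: s.1.2| <= 1)%N.
    by rewrite cardsCs finset.setCK card_ord -sB leq_subLR addn1.
  by move/card_le1P => /(_ _ us v); rewrite vs inE => /esym; rewrite eq_sym.
pose inv s := s = (i, B, P) \/ dstep (i, B, P) s.
have inv_step s t : dwalk (i, B, P) s -> inv s -> dstep s t -> inv t.
  move=> ws [-> st|st0 st]; [by right|left].
  move: (st0) => [u [/= uB sE _ [pQ PQ]]].
  move: st => [v [vs tE _ QR]].
  have vE : v = glue_perm T i u u.
    apply: (B_codim s) => //; rewrite sE /=.
    by rewrite mem_imset //; apply: perm_inj.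
  case: s t ws st0 sE pQ PQ vs tE QR => [[j C] Q] [[k D] R] /= ws st0 [-> ->].
  move=> pQ PQ vs; rewrite vE glue_tetK glue_permK => -[-> ->].
  rewrite -imset_comp (eq_imset (g := id)) ?imset_id; last by move=> w /=; rewrite permK.
  rewrite /neighbour glue_tetK glue_permK => -[pR QR]; congr pair.
  apply/esym/(placement_uniq (u := u) pP pR) => w wu.
  by rewrite -PQ // -QR ?permK // (inj_eq perm_inj).
case: (dwalk_inv inv_step (or_introl erefl) walk) => [[]//|].
move=> [u [/= uB [iE BE] _ _]].
have : glue_perm T i u u \notin B.
  by rewrite BE mem_imset //; apply: perm_inj.
move=> /(B_codim (i, B, P) _ _ (rt_refl _ _ _) uB) gu.
by have := glue_neq T i u; rewrite -gu -iE eqxx.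
Qed.

(** A walk is tracked by a flag y in the orbit of x: the ends of the edge keep their images, and
    [turn_ratio] locates the third vertex. Back at the initial edge, [orbit_edge_inj] gives y = x,
    the ratio is 1, and three vertices fix the placement. *)
Lemma holonomy_edge i (B : {set 'I_4}) P P' : #|B| = 2 -> placement i P ->
  dwalk (i, B, P) (i, B, P') -> P = P'.
Proof.
move=> /eqP/cards2P[v [w [vw ->]]] pP walk.
have [p [p0 p1 p_pos]] := perm4_exists (o i) vw.
pose x : flag n := (i, p); have x_pos : positive o x by [].
pose inv (s : pstate) := exists q, let y := (s.1.1, q) in
  [/\ fconnect (turn T) x y, s.1.2 = [set q 0; q 1]%SET,
      s.2 (q 0) = P v /\ s.2 (q 1) = P w
    & cross (P v) (P w) (P (p 2)) (turn_ratio x y) (s.2 (q 2))].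
have inv_step s t : dwalk (i, [set v; w]%SET, P) s -> inv s -> dstep s t -> inv t.
  case: s t => [[j C] Q] [[k D] R] ws [q [/= xy CE [Q0 Q1] Qcr]] [u [/=]].
  rewrite CE !inE negb_or => /andP[u0 u1] [-> ->] [Q_inj Qcross] [[R_inj Rcross] QR].
  have y_pos : positive o (j, q) := orbit_positive To x_pos xy.
  have [uE|uE] : u = q 2 \/ u = q 3.
    by case: (perm4_onto q u) u0 u1 => ->; rewrite ?eqxx //; [left|right].
  - have [t0 t1 t2 t3] := turnE T (j, q).
    exists (turn T (j, q)).2.
    have -> : (glue_tet T j u, (turn T (j, q)).2) = turn T (j, q).
      by rewrite uE.
    rewrite t0 t1 t2 /= -uE imsetU1 imset_set1 !QR ?uE ?(inj_eq perm_inj) //.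
    split=> //; first by rewrite (connect_trans xy) // fconnect1.
    rewrite turn_ratioS //; apply: cross_mul Qcr _; rewrite -?Q0 -?Q1.
    + by move/Q_inj; apply: perm4_neq.
    + by move/Q_inj; apply: perm4_neq.
    + exact: Qcross.
  - have [t t0 t1 t2 t3] := turn_backE T (j, q).
    exists (turn_back T (j, q)).2.
    have yE : (glue_tet T j u, (turn_back T (j, q)).2) = turn_back T (j, q).
      by rewrite uE -[glue_tet _ _ _]t -surjective_pairing.
    have z_con := fconnect_turn_back xy; have z_pos := orbit_positive To x_pos z_con.
    rewrite yE; have := Rcross (turn_back T (j, q)).2; rewrite yE => /(_ z_pos).
    rewrite t0 t1 t2 t3 /= -uE imsetU1 imset_set1 !(QR (q _)) ?uE ?(inj_eq perm_inj) //.
    move=> Zcr; split=> //.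
    have -> : turn_ratio x (turn_back T (j, q)) =
        (shape (turn_back T (j, q)))^-1 * turn_ratio x (j, q).
      by have := turn_ratioS x_pos z_con; rewrite turn_backK => ->;
        rewrite mulKf // shape_neq0.
    apply: cross_mul Qcr _; rewrite -?Q0 -?Q1.
    + by move/Q_inj; apply: perm4_neq.
    + by move/Q_inj; apply: perm4_neq.
    + by apply: cross_sym; rewrite ?shape_neq0.
have inv0 : inv (i, [set v; w]%SET, P).
  exists p; rewrite /= p0 p1 -/x turn_ratio_refl; split=> //.
  exact: cross1.
have [q [/= xy BE [Q0 Q1] Qcr]] := dwalk_inv inv_step inv0 walk.
have [qE] : x = (i, q).
  by apply: (orbit_edge_inj To x_pos xy) => //=; rewrite p0 p1.
rewrite -qE p0 p1 in Q0 Q1 Qcr; rewrite turn_ratio_refl in Qcr.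
have [P_inj _] := pP; have pP' := dwalk_placement walk pP.
apply: (placement_uniq (u := p 3) pP pP') => a.
case: (perm4_onto p a) => ->; rewrite ?p0 ?p1 ?Q0 ?Q1 ?eqxx // => _.
have neq (c d : 'I_4) : c != d -> P (p c) <> P (p d).
  by move=> cd /P_inj; apply: perm4_neq.
rewrite -p0 -p1 in Qcr.
apply: (cross_inj (oner_neq0 F) (neq 0 1 isT) (neq 2 0 isT) (neq 2 1 isT)) Qcr.
exact: cross1.
Qed.

Lemma holonomy i (B : {set 'I_4}) P P' : (1 < #|B|)%N -> placement i P ->
  dwalk (i, B, P) (i, B, P') -> P = P'.
Proof.
by rewrite leq_eqVlt => /orP[/eqP/esym|]; [apply: holonomy_edge|apply: holonomy_face].
Qed.

End Placements.

(** The supremum of the points reachable from a is itself reachable, and can be passed if it is less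
    than b. This takes the place of a subdivision by a Lebesgue number. *)
Lemma segment_induction (R : realType) (a b : R) (Q : R -> R -> Prop) :
    a <= b ->
    (forall x, a <= x -> x <= b -> exists2 e, 0 < e & forall c d,
       a <= c -> c <= x -> x <= d -> d <= b -> x - e < c -> d < x + e -> Q c d) ->
    (forall c d e, a <= c -> c <= d -> d <= e -> e <= b -> Q c d -> Q d e -> Q c e) ->
  Q a b.
Proof.
move=> ab Qloc Qtrans; pose E := [set x | [/\ a <= x, x <= b & Q a x]].
have Ea : E a.
  split=> //; have [e e0 Qe] := Qloc _ (lexx a) ab.
  by apply: Qe; rewrite // ?gtrBl // ltrDl.
have E_sup : has_sup E by split; [exists a | exists b => x []].
have as_ : a <= sup E by apply: sup_upper_bound.
have sb : sup E <= b by apply: ge_sup => [|x []]; first by exists a.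
have [e e0 Qe] := Qloc _ as_ sb.
have [x [ax xb Qax] sx] := sup_adherent e0 E_sup.
have xs : x <= sup E by apply: sup_upper_bound.
have Qas : Q a (sup E).
  by apply: (Qtrans _ x) => //; apply: Qe; rewrite // ltrDl.
pose d := Num.min b (sup E + e / 2).
have sd : sup E <= d by rewrite le_min sb lerDl divr_ge0 // ltW.
have Ed : E d.
  split; rewrite ?(le_trans as_ sd) ?ge_min ?lexx //.
  apply: (Qtrans _ (sup E)) => //; first by rewrite ge_min lexx.
  apply: Qe; rewrite ?gtrBl // ?ge_min ?lexx //.
  by rewrite gt_min [X in _ || X](_ : _ = true) ?orbT // ltrD2l; lra.
have : d <= sup E by apply: sup_upper_bound.
rewrite ge_min => /orP[bs|]; last by lra.
by have -> : b = sup E by apply: le_anti; rewrite bs sb.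
Qed.

Lemma open_forall (T : topologicalType) (I : finType) (A : I -> set T) :
  (forall i, open (A i)) -> open [set x | forall i, A i x].
Proof.
move=> A_open; rewrite openE => x Ax; rewrite /interior /=.
by apply: filter_forall => i; apply: open_nbhs_nbhs; split.
Qed.

Lemma open_imply (T : topologicalType) (b : Prop) (A : set T) :
  open A -> open [set x | b -> A x].
Proof.
move=> A_open; have [bT|bF] := pselect b.
  by rewrite (_ : [set _ | _] = A) //; apply/seteqP; split=> x //=; auto.
rewrite (_ : [set _ | _] = setT); first exact: openT.
by apply/seteqP; split=> // x _ /= /bF.
Qed.

(** * Simplices and normal triangles *)

Section Barycentric.
Variable R : realType.
Implicit Types (x : simplex3 R) (B : {set 'I_4}).

Lemma bary_ge0 x v : 0 <= bary x v.
Proof. by case: x => x; rewrite /bary /= => /set_mem[]. Qed.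

Lemma bary_sum x : \sum_v bary x v = 1.
Proof. by case: x => x; rewrite /bary /= => /set_mem[]. Qed.

Lemma open_simplex (A : set 'rV[R]_4) : open A ->
  open [set x : simplex3 R | A (\val x)].
Proof. by move=> A_open; exists A. Qed.

Definition support x : {set 'I_4} := [set v | 0 < bary x v]%SET.

(** An open condition satisfied by the points with support B, serving as a star neighbourhood of
    that cell. It is compatible with the face pairings, and a point has at most one such B of each
    size. *)
Definition top_set x B : Prop := (forall v, v \in B -> 0 < bary x v) /\
  (forall v w, v \in B -> w \notin B -> bary x w < bary x v).

Lemma top_support x : top_set x (support x).
Proof.
split=> [v|v w]; rewrite inE // => xv; rewrite inE -leNgt => xw.
exact: le_lt_trans xw xv.
Qed.

Lemma top_set_uniq x B C : top_set x B -> top_set x C -> #|B| = #|C| -> B = C.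
Proof.
move=> [_ topB] [_ topC] BC; apply/eqP; rewrite eqEcard BC leqnn andbT.
apply/fintype.subsetP => b bB; apply/negPn/negP => bC.
have /fintype.subsetPn[c cC cB] : ~~ (C \subset B).
  apply/negP => CB; have CB' : C = B by apply/eqP; rewrite eqEcard CB BC leqnn.
  by rewrite CB' bB in bC.
by have := lt_trans (topB _ _ bB cB) (topC _ _ cC bC); rewrite ltxx.
Qed.

Lemma top_set_open B : open [set x | top_set x B].
Proof.
have coord_open (g : 'rV[R]_4 -> R) : continuous g -> open [set r | 0 < g r].
  move=> g_cont; apply: open_comp (@open_gt _ 0) => r _; exact: g_cont.
have r_cont v : continuous (fun r : 'rV[R]_4 => r 0 v) by apply: coord_continuous.
apply: openI.
  apply: open_forall => v; apply: open_imply.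
  exact: (open_simplex (coord_open _ (r_cont v))).
apply: open_forall => v; apply: open_forall => w.
apply: open_imply; apply: open_imply.
have sub_cont : continuous (fun r : 'rV[R]_4 => r 0 v - r 0 w).
  by move=> r; exact: (cvgB (r_cont v r) (r_cont w r)).
have := open_simplex (coord_open _ sub_cont); congr open.
by apply/seteqP; split=> x /=; rewrite subr_gt0.
Qed.

End Barycentric.

Section Truncation.
Variables (R : realType) (n : nat) (T : triangulation n) (s : truncation R T).
Implicit Types x y : simplex3 R.

(* The normal triangle at vertex v of tetrahedron i is the set of points x with
   [cut_sum i v x = 1]. *)
Definition cut_sum i v x : R := \sum_(w | w != v) bary x w / Defs.cut s i v w.

Lemma cut_lt1 i v w : v != w -> Defs.cut s i v w < 1.
Proof.
move=> vw; have := cut_disj s i vw; have := cut_gt0 s i (v := w) (w := v).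
by rewrite eq_sym vw => /(_ isT); lra.
Qed.

Lemma ge_bary_div i v w x : v != w -> bary x w <= bary x w / Defs.cut s i v w.
Proof.
move=> vw; rewrite ler_pdivlMr ?cut_gt0 // ler_piMr ?bary_ge0 //.
exact/ltW/cut_lt1.
Qed.

(** On the face opposite v the remaining coordinates add up to 1, and each is divided by a cut below
    1. *)
Lemma cut_sum_gt1 i v x : bary x v = 0 -> 1 < cut_sum i v x.
Proof.
move=> xv; have sum1 : \sum_(w | w != v) bary x w = 1.
  by rewrite -(bary_sum x) [RHS](bigD1 v) //= xv add0r.
have [w wv xw] : exists2 w, w != v & 0 < bary x w.
  apply/not_exists2P => no_w; move/eqP: sum1.
  rewrite big1 ?(eq_sym 0) ?oner_eq0 // => w wv.
  have [//|] := no_w w; apply: contra_notP => xw.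
  by rewrite lt_neqAle bary_ge0 andbT eq_sym; apply/eqP.
rewrite /cut_sum (bigD1 w) //= -{1}sum1 (bigD1 w) //=; apply: ltr_leD.
  rewrite ltr_pdivlMr ?cut_gt0 1?eq_sym // gtr_pMr //.
  by apply: cut_lt1; rewrite eq_sym.
by apply: ler_sum => u /andP[uv _]; apply: ge_bary_div; rewrite eq_sym.
Qed.

Lemma cut_sum_glue i u v x y (g := glue_perm T i u) :
    bary x u = 0 -> (forall w, bary y (g w) = bary x w) -> v != u ->
  cut_sum (glue_tet T i u) (g v) y = cut_sum i v x.
Proof.
move=> xu xy vu; rewrite /cut_sum (reindex_inj (@perm_inj _ g)) /=.
apply: eq_big => [w|w]; first by rewrite (inj_eq perm_inj).
rewrite (inj_eq perm_inj) xy => wv.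
have [->|wu] := eqVneq w u; first by rewrite xu !mul0r.
by rewrite cut_glue // eq_sym.
Qed.

(** Comparing the cut sum at u with the sum of all coordinates bounds the v-coordinate by [cut u v]
    times the sum of the u- and v-coordinates. Adding the symmetric bound and using [cut_disj] makes
    both coordinates zero, against [cut_sum_gt1]. *)
Lemma cut_sum_uniq i u v x : cut_sum i u x = 1 -> cut_sum i v x = 1 -> u = v.
Proof.
move=> xu xv; apply/eqP/negPn/negP => uv.
have bound a b : a != b -> cut_sum i a x = 1 ->
    bary x b <= Defs.cut s i a b * (bary x a + bary x b).
  move=> ab; have := bary_sum x; rewrite (bigD1 a) //= (bigD1 b) 1?eq_sym //= => sumx.
  rewrite /cut_sum (bigD1 b) 1?eq_sym //= => cutx.
  have le_rest : \sum_(w | (w != a) && (w != b)) bary x w <=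
      \sum_(w | (w != a) && (w != b)) bary x w / Defs.cut s i a w.
    by apply: ler_sum => w /andP[wa _]; apply: ge_bary_div; rewrite eq_sym.
  rewrite mulrC -ler_pdivrMr ?cut_gt0 //; lra.
have lt1 : Defs.cut s i u v + Defs.cut s i v u < 1 by apply: cut_disj.
have bv := bound u v uv xu; have bu := bound v u; rewrite eq_sym uv in bu.
have {}bu := bu isT xv.
have xu0 := bary_ge0 x u; have xv0 := bary_ge0 x v.
have xu_eq0 : bary x u = 0.
  suff : bary x u + bary x v <= 0 by lra.
  rewrite leNgt; apply/negP => t0.
  have : (Defs.cut s i u v + Defs.cut s i v u) * (bary x u + bary x v)
      < 1 * (bary x u + bary x v) by rewrite ltr_pM2r.
  by move: bu bv; rewrite mulrDl mul1r (addrC (bary x v)); lra.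
by have := cut_sum_gt1 i xu_eq0; rewrite xu ltxx.
Qed.

Lemma cut_sum_open i v : open [set x | 1 < cut_sum i v x].
Proof.
have sum_cont : continuous (fun r : 'rV[R]_4 =>
    \sum_(w | w != v) r 0 w / Defs.cut s i v w).
  apply: (continuous_big add_continuous) => w _ r.
  exact: (cvgM (@coord_continuous R 1 4 0 w r) (cvg_cst (Defs.cut s i v w)^-1)).
by apply: (open_simplex (open_comp (fun r _ => sum_cont r) (@open_gt _ 1))).
Qed.

(** If no vertex but v is in the support, the cut sum at v vanishes. So the core avoids the
    vertices, around which [holonomy] gives nothing. *)
Lemma vertex_or_edge i x : (forall v, 1 <= cut_sum i v x) -> (1 < #|support x|)%N.
Proof.
move=> x_core; rewrite ltnNge; apply/negP => /card_le1P supp1.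
have [v xv] : exists v, forall w, w != v -> bary x w = 0.
  have eq0 w : w \notin support x -> bary x w = 0.
    by rewrite inE -leNgt => xw; apply: le_anti; rewrite xw bary_ge0.
  have [[v vx]|no_v] := pselect (exists v, v \in support x).
    by exists v => w wv; apply: eq0; rewrite (supp1 v vx) inE.
  by exists 0 => w _; apply: eq0; apply/negP => wx; apply: no_v; exists w.
have := x_core v; rewrite /cut_sum big1 ?ler10 // => w wv.
by rewrite xv // mul0r.
Qed.

Lemma edge_point_bary v w (t : R) u : 0 <= t <= 1 ->
  bary (edge_point v w t) u = (1 - t) * (u == v)%:R + t * (u == w)%:R.
Proof.
move=> /andP[t0 t1]; rewrite /bary /= mxE.
by have -> : clamp01 t = t by rewrite /clamp01 (min_idPl t1) (max_idPr t0).
Qed.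

Lemma edge_point_cut_sum i v w (t : R) : v != w -> 0 <= t <= 1 ->
  cut_sum i v (edge_point v w t) = t / Defs.cut s i v w.
Proof.
move=> vw t01; rewrite /cut_sum (bigD1 w) 1?eq_sym //= big1 => [|u /andP[uv uw]].
  by rewrite edge_point_bary // eqxx eq_sym (negPf vw) mulr0 mulr1 add0r addr0.
by rewrite edge_point_bary // (negPf uv) (negPf uw) !mulr0 addr0 mul0r.
Qed.

Lemma edge_pointC v w (t : R) : 0 <= t <= 1 -> edge_point v w t = edge_point w v (1 - t).
Proof.
move=> t01; apply: val_inj; apply/rowP => u.
have t01' : 0 <= 1 - t <= 1 by lra.
have := edge_point_bary v w u t01; have := edge_point_bary w v u t01'.
rewrite /bary /= => -> ->; ring.
Qed.

End Truncation.

(** * The developing space *)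

Section DevelopingSpace.
Variables (R : realType) (F : fieldType) (n : nat) (T : triangulation n).
Variables (o : 'I_n -> bool) (f : 'I_n -> {perm 'I_4}) (Z : 'M[F]_(n, 3)).
Hypothesis To : oriented T o.
Hypothesis fo : orientation_preserving o f.
Hypothesis Zrel : forall i, [/\ Z i 0 * (1 - Z i 2) = 1,
  Z i 1 * (1 - Z i 0) = 1 & Z i 2 * (1 - Z i 1) = 1].
Hypothesis Zglue : forall e, e \in edges T ->
  \prod_(i < n) (Z i 0 ^+ incidence f i e 0 * Z i 1 ^+ incidence f i e 1
                 * Z i 2 ^+ incidence f i e 2) = 1.

(* The points of the developing space: a point of a tetrahedron together with
   a placement of that tetrahedron. Identifying them by [devstep] gives a
   covering of the pseudo-manifold away from its vertices. *)
Definition devpoint : Type := (tetrahedra R n * ('I_4 -> option F))%type.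
Implicit Types (p r : tetrahedra R n) (d e : devpoint) (O : devpoint -> Prop).

Let placement := placement o f Z.
Let neighbour := neighbour T o f Z.
Let dwalk := dwalk T o f Z.

Definition base p : pseudo_manifold R T := (\pi_(pseudo_manifold R T) p)%qT.

Lemma base_eq p r : base p = base r <-> same_point T p r.
Proof. by split=> [/eqmodP //|pq]; apply/eqmodP. Qed.

Definition placed d : Prop := placement (projT1 d.1) d.2.

Definition devstep d e : Prop := exists u,
  [/\ bary (projT2 d.1) u = 0, projT1 e.1 = glue_tet T (projT1 d.1) u,
      forall v, bary (projT2 e.1) (glue_perm T (projT1 d.1) u v)
                = bary (projT2 d.1) v,
      placed d & neighbour (projT1 d.1) d.2 u e.2].

Definition devequiv : devpoint -> devpoint -> Prop := clos_refl_sym_trans _ devstep.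

Lemma glued_points_sym p r : glued_points T p r -> glued_points T r p.
Proof.
case: p r => [i x] [j y] [u [/= xu jE xy]].
subst j; exists (glue_perm T i u u); split=> /=; first by rewrite xy.
  by rewrite glue_tetK.
by move=> v; rewrite glue_permK -[in RHS](permKV (glue_perm T i u) v) xy.
Qed.

Lemma devstep_sym d e : devstep d e -> devstep e d.
Proof.
case: d e => [[i x] P] [[j y] Q] [u [/= xu jE xy pP PQ]].
subst j; exists (glue_perm T i u u); split=> /=; first by rewrite xy.
- by rewrite glue_tetK.
- by move=> v; rewrite glue_permK -[in RHS](permKV (glue_perm T i u) v) xy.
- by case: PQ.
- exact: neighbour_sym.
Qed.

Lemma devequiv_inv O : (forall d e, devstep d e -> O d -> O e) ->
  forall d e, devequiv d e -> O d <-> O e.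
Proof.
move=> O_step d e; elim=> {d e} [d e de|//|d e _ [] //|d e g _ [de ed] _ [eg ge]].
  by split; apply: O_step => //; apply: devstep_sym.
by split=> [/de/eg|/ge/ed].
Qed.

(** A placement extends across each face in a chain of identifications. Both directions are proved
    together because the chain may use a pairing backwards. *)
Lemma transport p r P : base p = base r -> placement (projT1 p) P ->
  exists2 Q, placement (projT1 r) Q & devequiv (p, P) (r, Q).
Proof.
move=> /base_eq /asboolP pr.
pose lifts p r := forall P, placement (projT1 p) P ->
  exists2 Q, placement (projT1 r) Q & devequiv (p, P) (r, Q).
suff [pq_lift _] : lifts p r /\ lifts r p by apply: pq_lift.
have lift_step p' r' : glued_points T p' r' -> lifts p' r'.
  case: p' r' => [i x] [j y] [u [/= xu jE xy]] P' pP.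
  subst j; have [Q PQ] := neighbour_exists T fo Zrel u pP.
  by exists Q; [case: PQ | apply: rst_step; exists u].
elim: pr => {p r P} [p q pq|p|p q _ []|p q r _ [pq qp] _ [qr rq]].
- by split; apply: lift_step => //; apply: glued_points_sym.
- by split=> P pP; exists P => //; apply: rst_refl.
- by split.
- split=> P pP.
  + have [Q pQ PQ] := pq _ pP; have [Q' pQ' QQ'] := qr _ pQ.
    by exists Q' => //; apply: rst_trans PQ QQ'.
  + have [Q pQ PQ] := rq _ pP; have [Q' pQ' QQ'] := qp _ pQ.
    by exists Q' => //; apply: rst_trans PQ QQ'.
Qed.

(* [devopen O]: the image of O is open in the quotient of the developing space. *)
Definition devopen O : Prop := (forall d e, devstep d e -> O d -> O e) /\
  forall i P, open [set x | O (existT _ i x, P)].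

Lemma devopenI O O' : devopen O -> devopen O' -> devopen (fun d => O d /\ O' d).
Proof.
move=> [Os Oo] [Os' Oo']; split=> [d e de [Od O'd]|i P].
  by split; [apply: Os de Od|apply: Os' de O'd].
by apply: openI; [apply: Oo|apply: Oo'].
Qed.

Definition devimage O : set (pseudo_manifold R T) :=
  [set c | exists d, [/\ placed d, O d & base d.1 = c]].

(** The projection of the developing space is open: by [transport], the preimage of the image in
    each tetrahedron is a union of open slices of O. *)
Lemma devimage_open O : devopen O -> open (devimage O).
Proof.
case=> O_step O_slice; rewrite /open /= /quotient_open.
apply/sigT_openP => i.
rewrite (_ : _ @^-1` _ = \bigcup_(P in [set P | placement i P])
    [set x | O (existT _ i x, P)]).
  by apply: bigcup_open.
apply/seteqP; split=> x /=.
  case=> [[p P] [/= pP OpP bp]]; have [Q pQ PQ] := transport bp pP.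
  by exists Q => //=; apply/(devequiv_inv O_step PQ).
by move=> [P /= pP OP]; exists (existT _ i x, P).
Qed.

Definition devstate d : pstate F n := (projT1 d.1, support (projT2 d.1), d.2).

(* The star of a marked developed tetrahedron is evenly covered when B has at
   least two elements. *)
Definition star (s : pstate F n) d : Prop :=
  exists2 C, dwalk s (projT1 d.1, C, d.2) & top_set (projT2 d.1) C.

Lemma star_self d : star (devstate d) d.
Proof. by exists (support (projT2 d.1)); [apply: rt_refl|apply: top_support]. Qed.

Lemma top_set_step d e u (B : {set 'I_4}) (g := glue_perm T (projT1 d.1) u) :
    bary (projT2 d.1) u = 0 ->
    (forall v, bary (projT2 e.1) (g v) = bary (projT2 d.1) v) ->
  top_set (projT2 d.1) B -> u \notin B /\ top_set (projT2 e.1) (g @: B).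
Proof.
move=> du de [B0 BB]; split; first by apply/negP => /B0; rewrite du ltxx.
split=> [v /imsetP[v' v'B ->]|v w /imsetP[v' v'B ->]]; first by rewrite de; apply: B0.
rewrite -[w](permKV g) mem_imset; last exact: perm_inj.
by rewrite !de; apply: BB.
Qed.

Lemma star_step (s : pstate F n) d e : devstep d e -> star s d -> star s e.
Proof.
case: d e => [[i x] P] [[j y] Q] [u [/= xu jE xy pP PQ]] [C sC topC].
subst j; have [uC topC'] := @top_set_step (existT _ i x, P)
  (existT _ (glue_tet T i u) y, Q) u C xu xy topC.
exists (glue_perm T i u @: C)%SET => //=.
by apply: rt_trans sC _; apply: rt_step; exists u.
Qed.

Lemma star_open s : devopen (star s).
Proof.
split=> [d e|i P]; first exact: star_step.
rewrite (_ : [set _ | _] = \bigcup_(C in [set C | dwalk s (i, C, P)])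
   [set x | top_set x C]).
  by apply: bigcup_open => C _; apply: top_set_open.
by apply/seteqP; split=> x /= [C ? ?]; exists C.
Qed.

(** After [transport] to the same tetrahedron point, both marked sets are top sets of equal size,
    hence equal, and [holonomy] identifies the placements. So a star is a single sheet. *)
Lemma star_inj (s : pstate F n) d e : (1 < #|s.1.2|)%N -> placed d ->
  star s d -> star s e -> base d.1 = base e.1 -> devequiv d e.
Proof.
move=> s1; case: d e => [p P] [q Q] pP sd [C /= sC topC] /= pq.
have [Q' pQ' PQ'] := transport pq pP.
have [C' /= sC' topC'] := (devequiv_inv (@star_step s) PQ').1 sd.
have CC' : C' = C.
  by apply: top_set_uniq topC' topC _; rewrite -(dwalk_card sC) -(dwalk_card sC').
rewrite CC' in sC'; suff <- : Q' = Q by [].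
apply: (holonomy To Zrel Zglue (B := C)) pQ' _; first by rewrite -(dwalk_card sC).
exact: rt_trans (dwalk_sym sC') sC.
Qed.

Lemma devstate_walk d e : devequiv d e -> dwalk (devstate d) (devstate e).
Proof.
elim=> {d e} [d e|d|d e _|d e g _ de _ eg].
- case: d e => [[i x] P] [[j y] Q] [u [/= xu jE xy pP PQ]].
  subst j; apply: rt_step; exists u; split=> //=; first by rewrite inE xu ltxx.
  congr pair; apply/setP => v.
  rewrite -[v](permKV (glue_perm T i u)) mem_imset; last exact: perm_inj.
  by rewrite !inE xy.
- exact: rt_refl.
- exact: dwalk_sym.
- exact: rt_trans de eg.
Qed.

(** Distinct points of a fibre have disjoint stars: a common point g closes up a walk, to which
    [holonomy] applies. *)
Lemma star_separated d e g : (1 < #|support (projT2 d.1)|)%N -> placed d ->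
  base d.1 = base e.1 -> star (devstate d) g -> star (devstate e) g -> devequiv d e.
Proof.
move=> d1; case: d e g d1 => [p P] [q Q] [r S] /= d1 pP pq [C dC topC] [C' eC' topC'].
have [Q' pQ' PQ'] := transport pq pP.
have walk := devstate_walk PQ'.
have suppE : #|support (projT2 p)| = #|support (projT2 q)| := dwalk_card walk.
have CC' : C' = C.
  apply: top_set_uniq topC' topC _.
  by rewrite -(dwalk_card dC) -(dwalk_card eC') /= suppE.
rewrite CC' in eC'; suff <- : Q' = Q by [].
apply: (holonomy To Zrel Zglue (B := support (projT2 q))) pQ' _; first by rewrite -suppE.
exact: rt_trans (dwalk_sym walk) (rt_trans _ _ _ _ _ dC (dwalk_sym eC')).
Qed.

(** Walks can be developed from any initial placement, so every point of the fibre lies on a sheet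
    covering the image of s. *)
Lemma star_sheet (s : pstate F n) d : placed d -> devimage (star s) (base d.1) ->
  exists t : pstate F n, [/\ #|t.1.2| = #|s.1.2|, star t d &
                forall c, devimage (star s) c -> devimage (star t) c].
Proof.
case: d => [p P] pP [[q Q] [/= pQ sQ qp]].
have [P' pP' QP'] := transport qp pQ.
have [C /= sC topC] := (devequiv_inv (@star_step s) QP').1 sQ.
exists (projT1 p, C, P); split=> /=; first by rewrite (dwalk_card sC).
  by exists C => //; apply: rt_refl.
move=> c [[r S] [/= pS [D sD topD] rc]].
have [S' pS' PS'] := dwalk_lift fo Zrel (rt_trans _ _ _ _ _ (dwalk_sym sC) sD) pP.
by exists (r, S'); split=> //; exists D.
Qed.

(** * Lifting *)

Section Lifting.
Variable Y : topologicalType.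
Implicit Types (q : Y).
Variables (A : set Y) (H : Y -> pseudo_manifold R T).
Hypothesis H_cont : forall q U, A q -> open U -> U (H q) ->
  \forall q' \near q, A q' -> U (H q').
Hypothesis H_edge : forall q p, A q -> base p = H q ->
  (1 < #|support (projT2 p)|)%N.
Implicit Types (D : set Y) (L K : Y -> devpoint).

(** Continuity into the quotient by [devequiv], tested on invariant open predicates; L may jump
    between equivalent representatives. *)
Definition is_lift D L : Prop :=
  (forall q, D q -> placed (L q) /\ base (L q).1 = H q) /\
  forall q O, D q -> devopen O -> O (L q) -> \forall q' \near q, D q' -> O (L q').

Definition liftable D : Prop := forall q d, D q -> placed d -> base d.1 = H q ->
  exists2 L, is_lift D L & L q = d.

Lemma local_lift q : A q -> exists2 N, nbhs q N &
  forall D, D `<=` A -> D `<=` N -> liftable D.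
Proof.
move=> Aq; have [p pq] : exists p, base p = H q by exists (repr (H q)); apply: reprK.
have [P pP] := placement_exists fo Zrel (projT1 p).
pose s := devstate (p, P); have s1 : (1 < #|s.1.2|)%N := H_edge Aq pq.
have Hq_img : devimage (star s) (H q).
  by exists (p, P); split=> //; apply: star_self.
exists [set q' | A q' -> devimage (star s) (H q')].
  by apply: H_cont => //; apply/devimage_open/star_open.
move=> D DA DN q0 d0 Dq0 pd0 bd0.
have [t [ts td0 st]] : exists t : pstate F n, [/\ #|t.1.2| = #|s.1.2|, star t d0 &
    forall c, devimage (star s) c -> devimage (star t) c].
  by apply: star_sheet => //; rewrite bd0; apply: DN => //; apply: DA.
(* The second conjunct makes L take the value d0 itself at q0, not merely an equivalent one. *)
have /choice[L LP] q' : exists e, (D q' -> [/\ placed e, star t e & base e.1 = H q'])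
    /\ (q' = q0 -> e = d0).
  have [->|q'q0] := pselect (q' = q0); first by exists d0.
  have [Dq'|Dq'] := pselect (D q'); last by exists d0.
  by have [e ?] := st _ (DN _ Dq' (DA _ Dq')); exists e.
exists L; last by apply: (LP q0).2.
split=> [q' /(LP q').1[]//|q' O Dq' O_open OL].
have [pL tL bL] := (LP q').1 Dq'.
have I_open := devimage_open (devopenI O_open (star_open t)).
have : devimage (fun d => O d /\ star t d) (H q') by exists (L q').
move=> /(H_cont (DA _ Dq') I_open); apply: filterS => q2 q2_img Dq2.
have [e [pe [Oe te] be]] := q2_img (DA _ Dq2).
have [pL2 tL2 bL2] := (LP q2).1 Dq2.
apply: (devequiv_inv O_open.1 _).1 Oe.
by apply: (star_inj _ pe te tL2); rewrite ?ts // be bL2.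
Qed.

(** Both agreement and disagreement of two lifts persist nearby, by [star_inj] and [star_separated]
    respectively. *)
Lemma lift_near D L K q : D `<=` A -> is_lift D L -> is_lift D K -> D q ->
  \forall q' \near q, D q' -> devequiv (L q) (K q) <-> devequiv (L q') (K q').
Proof.
move=> DA [Lb Lc] [Kb Kc] Dq.
have [pL bL] := Lb q Dq; have [pK bK] := Kb q Dq.
have L1 := H_edge (DA _ Dq) bL.
have := Lc q _ Dq (star_open (devstate (L q))) (star_self (L q)).
have := Kc q _ Dq (star_open (devstate (K q))) (star_self (K q)).
apply: filterS2 => q' Kq' Lq' Dq'; have {}Kq' := Kq' Dq'; have {}Lq' := Lq' Dq'.
have [pL' bL'] := Lb q' Dq'; have [pK' bK'] := Kb q' Dq'.
split=> [LK|LK'].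
- apply: (@star_inj (devstate (L q))) => //; last by rewrite bL' bK'.
  have [C wC topC] := Kq'; exists C => //.
  exact: rt_trans (devstate_walk LK) wC.
- apply: (star_separated L1 pL _ Lq'); first by rewrite bL bK.
  exact/(devequiv_inv (@star_step _) LK').
Qed.

Lemma lift_uniq D L K (g : R -> Y) a b : D `<=` A -> is_lift D L -> is_lift D K ->
  continuous g -> a <= b -> (forall t, a <= t -> t <= b -> D (g t)) ->
  devequiv (L (g a)) (K (g a)) -> devequiv (L (g b)) (K (g b)).
Proof.
move=> DA LL LK g_cont ab gD.
suff : devequiv (L (g a)) (K (g a)) <-> devequiv (L (g b)) (K (g b)) by case.
apply: (@segment_induction _ a b (fun s t =>
  devequiv (L (g s)) (K (g s)) <-> devequiv (L (g t)) (K (g t)))) => //.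
  move=> x ax xb; have := lift_near DA LL LK (gD _ ax xb).
  move=> /(g_cont x) /nbhs_ballP[e /= e0 xe]; exists e => // c d ac cx xd db ec de.
  have xc := xe c; have xd' := xe d; rewrite /= /ball /= in xc xd'.
  have -> : devequiv (L (g c)) (K (g c)) <-> devequiv (L (g x)) (K (g x)).
    apply: iff_sym; apply: xc; first by rewrite ger0_norm ?subr_ge0 //; lra.
    by apply: gD => //; apply: le_trans cx xb.
  apply: xd'; first by rewrite ler0_norm ?subr_le0 //; lra.
  by apply: gD => //; apply: le_trans ax xd.
by move=> c d e _ _ _ _ cd de; apply: iff_trans cd de.
Qed.

Lemma is_liftW D D' L : D' `<=` D -> is_lift D L -> is_lift D' L.
Proof.
move=> DD' [Lb Lc]; split=> [q /DD'/Lb //|q O /DD' Dq O_open OL].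
by have := Lc q O Dq O_open OL; apply: filterS => q' Lq' /DD'.
Qed.

Lemma liftableW D D' : D' `<=` D -> liftable D -> liftable D'.
Proof.
move=> DD' D_lift q d Dq pd bd; have [L LL Lq] := D_lift q d (DD' _ Dq) pd bd.
by exists L => //; apply: is_liftW LL.
Qed.

(** The second lift is started from the first at one point of the overlap. The overlap is the arc g,
    so [lift_uniq] makes them equivalent all along it, and closedness of the pieces lets continuity
    be checked on each. *)
Lemma liftable_union D1 D2 (g : R -> Y) a b : D1 `<=` A -> D2 `<=` A ->
    closed D1 -> closed D2 -> continuous g -> a <= b ->
    (forall t, a <= t -> t <= b -> D1 (g t) /\ D2 (g t)) ->
    (forall q, D1 q -> D2 q -> exists t, [/\ a <= t, t <= b & g t = q]) ->
  liftable D1 -> liftable D2 -> liftable (D1 `|` D2).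
Proof.
move=> D1A D2A.
wlog suff one : D1 D2 D1A D2A / closed D1 -> closed D2 -> continuous g -> a <= b ->
    (forall t, a <= t -> t <= b -> D1 (g t) /\ D2 (g t)) ->
    (forall q, D1 q -> D2 q -> exists t, [/\ a <= t, t <= b & g t = q]) ->
    liftable D1 -> liftable D2 ->
  forall q d, D1 q -> placed d -> base d.1 = H q ->
  exists2 L, is_lift (D1 `|` D2) L & L q = d.
  move=> c1 c2 gc ab gD Dg l1 l2 q d [D1q|D2q] pd bd; first exact: (one D1 D2).
  rewrite setUC; apply: (one D2 D1) => //.
    by move=> t ta tb; have [] := gD t ta tb.
  by move=> q' ? ?; apply: Dg.
move=> c1 c2 gc ab gD Dg l1 l2 q d D1q pd bd.
have [L LL Lq] := l1 q d D1q pd bd.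
have [D1ga D2ga] := gD a (lexx a) ab.
have [pLa bLa] := LL.1 _ D1ga.
have [K KK Ka] := l2 _ _ D2ga pLa bLa.
have LK q' : D1 q' -> D2 q' -> devequiv (L q') (K q').
  move=> D1q' D2q'; have [t [ta tb <-]] := Dg _ D1q' D2q'.
  apply: (@lift_uniq (D1 `&` D2) L K g a t) => //.
  - by move=> ? [/D1A].
  - by apply: is_liftW LL => ? [].
  - by apply: is_liftW KK => ? [].
  - by move=> t' ta' tb'; apply: gD => //; apply: le_trans tb' tb.
  - by rewrite Ka; apply: rst_refl.
pose M q := if pselect (D1 q) then L q else K q.
have M1 q' : D1 q' -> M q' = L q' by rewrite /M; case: pselect.
have M2 q' : ~ D1 q' -> M q' = K q' by rewrite /M; case: pselect.
have KM q' O : devopen O -> D2 q' -> O (K q') -> O (M q').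
  move=> O_open D2q' OK; have [D1q'|D1q'] := pselect (D1 q'); last by rewrite M2.
  by rewrite M1 //; apply/(devequiv_inv O_open.1 (LK _ D1q' D2q')).
have MK q' O : devopen O -> D2 q' -> O (M q') -> O (K q').
  move=> O_open D2q'; have [D1q'|D1q'] := pselect (D1 q'); last by rewrite M2.
  by rewrite M1 // => OL; apply/(devequiv_inv O_open.1 (LK _ D1q' D2q')).
have near_in D (N : Y -> devpoint) q' O : closed D -> is_lift D N -> devopen O ->
    (D q' -> O (N q')) -> \forall q2 \near q', D q2 -> O (N q2).
  move=> D_cl [_ Nc] O_open ON; have [Dq'|Dq'] := pselect (D q').
    exact: Nc (ON Dq').
  have : nbhs q' (~` D) by apply: open_nbhs_nbhs; split=> //; apply: closed_openC.
  by apply: filterS => q2.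
exists M; last by rewrite M1.
split=> [q' D12q'|q' O D12q' O_open OM].
  have [D1q'|D1q'] := pselect (D1 q'); first by rewrite M1 //; apply: LL.1.
  by rewrite M2 //; apply: KK.1; case: D12q'.
have n1 : \forall q2 \near q', D1 q2 -> O (L q2).
  by apply: (near_in D1) => // D1q'; rewrite -M1.
have n2 : \forall q2 \near q', D2 q2 -> O (K q2).
  by apply: (near_in D2) => // D2q'; apply: MK.
apply: filterS2 n1 n2 => q2 L2 K2 [D1q2|D2q2]; first by rewrite M1 //; apply: L2.
by apply: KM => //; apply: K2.
Qed.

End Lifting.

(** * Lifting over the unit square *)

Definition rect (a b c d : R) : set (R * R) :=
  [set q | (a <= q.1 <= b) && (c <= q.2 <= d)].

Lemma rect_closed (a b c d : R) : closed (rect a b c d).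
Proof.
have between_closed (x y : R) (g : R * R -> R) : continuous g ->
    closed [set q | x <= g q <= y].
  move=> g_cont; rewrite (_ : [set _ | _] = g @^-1` [set t | x <= t] `&`
      g @^-1` [set t | t <= y]).
    have g_in (B : set R) : {in ~` (g @^-1` B), continuous g}.
      by move=> q _; apply: g_cont.
    by apply: closedI; [apply: closed_comp (g_in _) (@closed_ge _ x)
                       |apply: closed_comp (g_in _) (@closed_le _ y)].
  by apply/seteqP; split=> q /= => [/andP//|[-> ->]].
rewrite (_ : rect a b c d = [set q | a <= q.1 <= b] `&` [set q | c <= q.2 <= d]).
  by apply: closedI; apply: between_closed => q; [exact: cvg_fst|exact: cvg_snd].
by apply/seteqP; split=> q /= => [/andP//|[? ?]]; apply/andP.
Qed.

Section Square.
Variable H : R * R -> pseudo_manifold R T.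
Let A := rect 0 1 0 1.
Hypothesis H_cont : forall q U, A q -> open U -> U (H q) ->
  \forall q' \near q, A q' -> U (H q').
Hypothesis H_edge : forall q p, A q -> base p = H q ->
  (1 < #|support (projT2 p)|)%N.

Lemma strip_lift (x : R) : 0 <= x -> x <= 1 -> exists2 e : R, 0 < e & forall a b,
  0 <= a -> a <= x -> x <= b -> b <= 1 -> x - e < a -> b < x + e ->
  liftable H (rect a b 0 1).
Proof.
move=> x0 x1.
apply: (@segment_induction _ 0 1 (fun c d : R => exists2 e : R, 0 < e & forall a b,
  0 <= a -> a <= x -> x <= b -> b <= 1 -> x - e < a -> b < x + e ->
  liftable H (rect a b c d))) => //.
- move=> y y0 y1.
  have [|N /nbhs_ballP[e /= e0 eN] NP] := local_lift H_cont H_edge (q := (x, y)).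
    by rewrite /A /rect /= x0 x1 y0 y1.
  exists e => // c d c0 cy yd d1 ec de; exists e => // a b a0 ax xb b1 ea be.
  apply: NP => [q|q] /= /andP[/andP[aq qb] /andP[cq qd]].
    by rewrite /A /rect /= (le_trans a0 aq) (le_trans qb b1) (le_trans c0 cq)
      (le_trans qd d1).
  apply: eN; split; rewrite /ball /= ltr_norml; apply/andP; split; lra.
- move=> c d e c0 cd de e1 [r1 r10 l1] [r2 r20 l2].
  exists (Num.min r1 r2); first by rewrite lt_min r10.
  move=> a b a0 ax xb b1; rewrite ltrBlDr -ltrBlDl => ea be.
  have ea1 : x - r1 < a by move: ea; rewrite lt_min => /andP[? _]; lra.
  have ea2 : x - r2 < a by move: ea; rewrite lt_min => /andP[_ ?]; lra.
  have be1 : b < x + r1 by move: be; rewrite -ltrBlDl lt_min => /andP[? _]; lra.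
  have be2 : b < x + r2 by move: be; rewrite -ltrBlDl lt_min => /andP[_ ?]; lra.
  have ab : a <= b by apply: le_trans ax xb.
  apply: (@liftableW _ _ (rect a b c d `|` rect a b d e)).
    move=> q /= /andP[qab /andP[cq qe]].
    by case: (leP q.2 d) => qd; [left|right]; rewrite /rect /= qab ?cq ?qd ?qe ?(ltW qd).
  apply: (liftable_union H_edge (g := fun t => (t, d)) (a := a) (b := b)) => //.
  + move=> q /= /andP[/andP[aq qb] /andP[cq qd]].
    by rewrite /A /rect /=; apply/andP; split; apply/andP; split; lra.
  + move=> q /= /andP[/andP[aq qb] /andP[cq qd]].
    by rewrite /A /rect /=; apply/andP; split; apply/andP; split; lra.
  + exact: rect_closed.
  + exact: rect_closed.
  + by move=> t; exact: (cvg_pair cvg_id (cvg_cst d)).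
  + by move=> t ta tb; rewrite /rect /= ta tb cd de !lexx.
  + move=> q /= /andP[/andP[aq qb] /andP[_ qd]] /andP[_ /andP[dq _]].
    exists q.1; split=> //; rewrite [q in RHS]surjective_pairing; congr pair.
    by apply: le_anti; rewrite dq qd.
  + exact: l1.
  + exact: l2.
Qed.

Lemma square_lift : liftable H A.
Proof.
apply: (@segment_induction _ 0 1 (fun a b => liftable H (rect a b 0 1))) => //.
- by move=> x x0 x1; apply: strip_lift.
- move=> a b c a0 ab bc c1 l1 l2.
  apply: (@liftableW _ _ (rect a b 0 1 `|` rect b c 0 1)).
    move=> q /= /andP[/andP[aq qc] q01].
    by case: (leP q.1 b) => qb; [left|right]; rewrite /rect /= q01 ?aq ?qc ?qb ?(ltW qb).
  apply: (liftable_union H_edge (g := fun t => (b, t)) (a := 0) (b := 1)) => //.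
  + move=> q /= /andP[/andP[aq qb] /andP[cq qd]].
    by rewrite /A /rect /=; apply/andP; split; apply/andP; split; lra.
  + move=> q /= /andP[/andP[aq qb] /andP[cq qd]].
    by rewrite /A /rect /=; apply/andP; split; apply/andP; split; lra.
  + exact: rect_closed.
  + exact: rect_closed.
  + by move=> t; exact: (cvg_pair (cvg_cst b) cvg_id).
  + by move=> t ta tb; rewrite /rect /= ta tb ab bc !lexx.
  + move=> q /= /andP[/andP[_ qb] /andP[q0 q1]] /andP[/andP[bq _] _].
    exists q.2; split=> //; rewrite [q in RHS]surjective_pairing; congr pair.
    by apply: le_anti; rewrite bq qb.
Qed.

End Square.

(** * Ideal vertices along arcs *)

Section Essential.
Variable s : truncation R T.

(** With S everything, this open condition detects the interior of the core; with S the complement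
    of a point c, it leaves c as the only ideal vertex that can be faced. *)
Definition outside (S : set (option F)) d : Prop :=
  forall v, S (d.2 v) -> 1 < cut_sum s (projT1 d.1) v (projT2 d.1).

Lemma outside_open S : devopen (outside S).
Proof.
split=> [d e|i P]; last first.
  apply: open_forall => v.
  by apply: (@open_imply _ (S (P v)) [set x | 1 < cut_sum s i v x]); apply: cut_sum_open.
case: d e => [[i x] P] [[j y] Q] [u [/= xu jE xy pP PQ]] out v' /=.
subst j; rewrite -[v'](permKV (glue_perm T i u)).
move: ((glue_perm T i u)^-1%g v') => v SQ.
have [vu|vu] := eqVneq v u; first by apply: cut_sum_gt1; rewrite xy vu.
rewrite (cut_sum_glue s xu xy) //; apply: out => /=.
by case: PQ => _ <-.
Qed.

(* The point of d lies on a normal triangle around the ideal vertex a. *)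
Definition facing (a : option F) d : Prop :=
  exists2 v, d.2 v = a & cut_sum s (projT1 d.1) v (projT2 d.1) = 1.

Lemma facing_step a d e : devstep d e -> facing a d -> facing a e.
Proof.
case: d e => [[i x] P] [[j y] Q] [u [/= xu jE xy pP PQ]] [v /= <- xv].
have vu : v != u.
  apply/eqP => vu; have := @cut_sum_gt1 _ _ _ s i v x.
  by rewrite vu -vu xv ltxx vu => /(_ xu).
subst j; exists (glue_perm T i u v) => /=; first by case: PQ => _ ->.
by rewrite (cut_sum_glue s xu xy).
Qed.

Lemma core_cut_sum p v : core s (base p) -> 1 <= cut_sum s (projT1 p) v (projT2 p).
Proof.
case: p => i x /= cx; rewrite leNgt; apply/negP => xv; apply: cx.
by exists i => //; exists v => //; exists x.
Qed.

(** Otherwise all cut sums exceed 1, and the image of [outside setT] is an open neighbourhood of the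
    point inside the core. *)
Lemma frontier_cut_sum p : core s (base p) -> frontier (core s) (base p) ->
  exists v, cut_sum s (projT1 p) v (projT2 p) = 1.
Proof.
move=> cp [_ not_int]; apply/not_existsP => no_v; apply: not_int.
have [P pP] := placement_exists fo Zrel (projT1 p).
have out_p : outside setT (p, P).
  move=> v _; rewrite lt_neqAle core_cut_sum // andbT eq_sym.
  by apply/eqP; apply: no_v.
have : nbhs (base p) (devimage (outside setT)).
  apply: open_nbhs_nbhs; split; last by exists (p, P).
  exact/devimage_open/outside_open.
apply: filterS => c [[r Q] [/= pQ out_r <-]] [i _ [v _ [x xv xr]]].
have [Q' _ QQ'] := @transport r (existT _ i x) Q (esym xr) pQ.
have out_x := (devequiv_inv (outside_open setT).1 QQ').1 out_r.
by have := lt_trans (out_x v I) xv; rewrite ltxx.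
Qed.

Lemma facing_uniq a b d : facing a d -> facing b d -> a = b.
Proof.
by move=> [v <- dv] [w <- dw]; rewrite (cut_sum_uniq dv dw).
Qed.

Section Arc.
Variables (i : 'I_n) (v w : 'I_4).
Hypothesis vw : v != w.

Let param (t : R) : R := (1 - t) * Defs.cut s i v w + t * (1 - Defs.cut s i w v).
Let pt (t : R) : tetrahedra R n := existT _ i (edge_point v w (param t)).

Let cut_bounds : [/\ 0 < Defs.cut s i v w, 0 < Defs.cut s i w v &
  Defs.cut s i v w + Defs.cut s i w v < 1].
Proof. by split; [apply: cut_gt0|apply: cut_gt0; rewrite eq_sym|apply: cut_disj]. Qed.

Let param01 (t : R) : 0 <= t <= 1 -> 0 <= param t <= 1.
Proof.
by move=> /andP[t0 t1]; have [c0 c1 c2] := cut_bounds; rewrite /param; nra.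
Qed.

Let facing_start P : facing (P v) (pt 0, P).
Proof.
have [c0 _ _] := cut_bounds; exists v => //=.
have p0 : 0 <= param 0 <= 1 by apply: param01; rewrite lexx ler01.
rewrite edge_point_cut_sum //.
by rewrite /param subr0 mul1r mul0r addr0 divff // gt_eqF.
Qed.

Let facing_end P : facing (P w) (pt 1, P).
Proof.
have [_ c0 _] := cut_bounds; exists w => //=.
have p1 : 0 <= param 1 <= 1 by apply: param01; rewrite lexx ler01.
have p1' : 0 <= 1 - param 1 <= 1 by move: p1; lra.
rewrite edge_pointC // edge_point_cut_sum //; last by rewrite eq_sym.
by rewrite /param subrr mul0r add0r mul1r subKr divff // gt_eqF.
Qed.

Let pt_lift (H : R * R -> pseudo_manifold R T) P : placement i P ->
    (forall t, 0 <= t <= 1 -> H (0, t) = base (pt t)) ->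
  is_lift H (rect 0 0 0 1) (fun q => (pt q.2, P)).
Proof.
move=> pP Hpt; split=> [q /= /andP[q0 q1]|q O /= /andP[_ q1] O_open Oq].
  split=> //; rewrite -Hpt // [q in RHS]surjective_pairing; congr (H (_, _)).
  exact: le_anti.
(* For 0 <= t <= 1 the arc is a + t b, an affine map continuous for all t, so continuity of
   [clamp01] need not be treated. *)
pose a : 'rV[R]_4 := \row_u ((1 - Defs.cut s i v w) * (u == v)%:R
                          + Defs.cut s i v w * (u == w)%:R).
pose b : 'rV[R]_4 := \row_u ((1 - Defs.cut s i v w - Defs.cut s i w v)
                          * ((u == w)%:R - (u == v)%:R)).
have [U U_open UE] := O_open.2 i P.
have ptE t : 0 <= t <= 1 -> \val (edge_point v w (param t)) = a + t *: b.
  move=> t01; apply/rowP => u; rewrite [LHS](edge_point_bary _ _ _ (param01 t01)) !mxE.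
  rewrite /param; ring.
have UO t : 0 <= t <= 1 -> U (a + t *: b) <-> O (pt t, P).
  move=> t01; rewrite -ptE //.
  by have := congr1 (@^~ (edge_point v w (param t))) UE => /= ->.
have g_cont : continuous (fun q' : R * R => a + q'.2 *: b).
  move=> q'; exact: (cvgD (cvg_cst a) (cvgZr_tmp (@cvg_snd _ _ _ _ _))).
have : nbhs q [set q' : R * R | U (a + q'.2 *: b)].
  by apply: g_cont; apply: open_nbhs_nbhs; split=> //; apply/UO.
by apply: filterS => q' Uq' /andP[_ q'1]; apply/UO.
Qed.

Lemma arc_essential (h : R -> pseudo_manifold R T) :
    path_in (frontier (core s)) h ->
    homotopic_rel_ends_in (core s) (edge_arc s i v w) h ->
  False.
Proof.
move=> [_ h_frontier] [H [H_cont H_core H_sides H_ends]].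
pose A := rect 0 1 0 1.
have AE : `[0, 1]%classic `*` `[0, 1]%classic = A.
  by apply/seteqP; split=> q; rewrite /A /rect /= !in_itv /=; [case=> -> ->|case/andP].
have {}H_core q : A q -> core s (H q).
  by move=> Aq; apply: H_core; exists q; rewrite // AE.
have {}H_cont q U : A q -> open U -> U (H q) -> \forall q' \near q, A q' -> U (H q').
  move=> Aq U_open UHq; move: H_cont; rewrite AE => /subspace_continuousP /(_ q Aq U).
  by apply; apply: open_nbhs_nbhs.
have H_edge q p : A q -> base p = H q -> (1 < #|support (projT2 p)|)%N.
  move=> Aq pq; apply: (@vertex_or_edge _ _ _ s (projT1 p)) => u.
  by apply: core_cut_sum; rewrite pq; apply: H_core.
have in01 (t : R) : 0 <= t <= 1 -> t \in `[0, 1]%R by rewrite in_itv.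
have H0 (t : R) : 0 <= t <= 1 -> H (0, t) = base (pt t) by move=> /in01/H_sides[->].
have A01 (a b : R) : 0 <= a <= 1 -> 0 <= b <= 1 -> A (a, b).
  by rewrite /A /rect /= => -> ->.
have z01 : is_true (0 <= (0 : R) <= 1) by rewrite ler01 lexx.
have o01 : is_true (0 <= (1 : R) <= 1) by rewrite ler01 lexx.
have [P pP] := placement_exists fo Zrel i.
have [L LL L00] : exists2 L, is_lift H A L & L (0, 0) = (pt 0, P).
  by apply: (square_lift H_cont H_edge) => //; rewrite ?(H0 _ z01) //; exact: A01.
have L01 : devequiv (L (0, 1)) (pt 1, P).
  have D_A : rect 0 0 0 1 `<=` A.
    by move=> q /= /andP[q0 q1]; rewrite /A /rect /= q1 andbT; lra.
  apply: (lift_uniq H_edge (D := rect 0 0 0 1) (g := fun t => (0, t)) (a := 0) (b := 1)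
    (K := fun q => (pt q.2, P)) D_A (is_liftW D_A LL) (pt_lift pP H0)) => //.
  - by move=> t; exact: (cvg_pair (cvg_cst 0) cvg_id).
  - by move=> t t0 t1; rewrite /rect /= lexx t0 t1.
  - by rewrite L00; apply: rst_refl.
(* H is constant on this side of the square, so a constant map lifts it and uniqueness compares that
   map with L. *)
have L_ends (b : R) : b = 0 \/ b = 1 -> devequiv (L (0, b)) (L (1, b)).
  move=> b01; have b_in : 0 <= b <= 1 by case: b01 => ->.
  have D_A : rect 0 1 b b `<=` A.
    by move=> q /= /andP[q0 q1]; rewrite /A /rect /= q0 /=; lra.
  have HD q : rect 0 1 b b q -> H q = H (0, b).
    move=> /= /andP[q0 q1]; have qb : q.2 = b by apply: le_anti; rewrite andbC.
    have Hu (u : R) : 0 <= u <= 1 -> H (u, b) = edge_arc s i v w b.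
      by move=> /in01/H_ends[]; case: b01 => ->.
    by rewrite [q]surjective_pairing qb !Hu.
  apply: rst_sym.
  apply: (lift_uniq H_edge (D := rect 0 1 b b) (g := fun t => (t, b)) (a := 0) (b := 1)
    (K := fun q => L (0, b)) D_A (is_liftW D_A LL)) => //.
  - split=> [q /HD ->|q O _ _ Oq]; last by apply: (@filterE _ (nbhs q)) => q' _.
    by apply: LL.1; apply: A01.
  - by move=> t; exact: (cvg_pair cvg_id (cvg_cst b)).
  - by move=> t t0 t1; rewrite /rect /= lexx t0 t1.
  - exact: rst_refl.
have L_facing a : facing a (L (1, 0)) <-> facing a (L (1, 1)).
  have L_front (t : R) : 0 <= t <= 1 ->
      exists u, cut_sum s (projT1 (L (1, t)).1) u (projT2 (L (1, t)).1) = 1.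
    move=> t01; have [_ bL] := LL.1 _ (A01 _ _ o01 t01).
    apply: frontier_cut_sum; rewrite bL; first exact/H_core/A01.
    have [_ ->] := H_sides t (in01 t t01); apply: h_frontier.
    by exists t => //; apply: in01.
  apply: (@segment_induction _ 0 1
    (fun b c : R => facing a (L (1, b)) <-> facing a (L (1, c)))) => //; last first.
    by move=> b c d _ _ _ _; apply: iff_trans.
  move=> x x0 x1; have x01 : 0 <= x <= 1 by rewrite x0 x1.
  have [u xu] := L_front x x01; pose c := (L (1, x)).2 u.
  (* Lying strictly outside all triangles but those at c is an open condition, and a frontier point
     must lie on some triangle; so all nearby points of the path face c. *)
  have out_x : outside [set b | b <> c] (L (1, x)).
    move=> u' u'c; have [_ bL] := LL.1 _ (A01 _ _ o01 x01).
    rewrite lt_neqAle eq_sym core_cut_sum ?bL; last exact/H_core/A01.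
    by rewrite andbT; apply/eqP => /cut_sum_uniq /(_ xu) u'u; apply: u'c; rewrite u'u.
  have := LL.2 _ _ (A01 _ _ o01 x01) (outside_open _) out_x.
  have g_cont : continuous ((fun t => (1, t)) : R -> R * R).
    by move=> t; exact: (cvg_pair (cvg_cst (1 : R)) cvg_id).
  move=> /(g_cont x) /nbhs_ballP[e /= e0 xe].
  have facing_near (t : R) : 0 <= t <= 1 -> x - e < t -> t < x + e ->
      facing a (L (1, t)) <-> a = c.
    move=> t01 et te; have [u' tu'] := L_front t t01.
    have out_t : outside [set b | b <> c] (L (1, t)).
      apply: (xe t); last exact: A01.
      by rewrite /ball /= ltr_norml; lra.
    have tc : facing c (L (1, t)).
      exists u' => //; apply: contrapT => u'c.
      by have := out_t u' u'c; rewrite tu' ltxx.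
    by split=> [ta|->//]; apply: facing_uniq ta tc.
  exists e => // b d b0 bx xd d1 eb de.
  apply: (@iff_trans _ (a = c)); first by apply: facing_near; lra.
  by apply: iff_sym; apply: facing_near; lra.
have facing_equiv a d e : devequiv d e -> facing a d <-> facing a e.
  by apply: devequiv_inv => {}d {}e; apply: facing_step.
have : facing (P v) (pt 1, P).
  apply/(facing_equiv _ _ _ L01)/(facing_equiv _ _ _ (L_ends 1 (or_intror erefl))).
  apply/L_facing/(facing_equiv _ _ _ (L_ends 0 (or_introl erefl))).
  by rewrite L00; apply: facing_start.
move=> /facing_uniq /(_ (facing_end P)) /pP.1 /eqP.
exact/negP.
Qed.

End Arc.
End Essential.

End DevelopingSpace.

Theorem theorem1 (R : realType) (n : nat) (T : triangulation n)
    (o : 'I_n -> bool) (To : oriented T o)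
    (f : 'I_n -> {perm 'I_4}) (fo : orientation_preserving o f)
    (s : truncation R T) :
  deformation_variety R T f !=set0 ->
  forall e, e \in edges T -> essential s e.
Proof.
move=> [Z [_ Zrel Zglue]] e _ i v w vw _ [h [h_path h_homotopic]].
exact: (arc_essential To fo Zrel Zglue vw h_path h_homotopic).
Qed.
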